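(* Let $\mathsf{K}^\ast=\begin{bmatrix}0&C_{\mathsf K^\ast}\\ B_{\mathsf K^\ast}&A_{\mathsf K^\ast}\end{bmatrix}\in\mathcal{C}_{n,0}$ be a stationary point of $J_{\mathtt{LQG},n}$, i.e., $\nabla J_{\mathtt{LQG},n}(\mathsf{K}^\ast)=0$. If $\mathsf{K}^\ast$ corresponds to a minimal policy, i.e., $(A_{\mathsf K^\ast},B_{\mathsf K^\ast})$ is controllable and $(C_{\mathsf K^\ast},A_{\mathsf K^\ast})$ is observable, then $\mathsf{K}^\ast$ is a non-degenerate policy for LQG, and thus it is a global minimum of $J_{\mathtt{LQG},n}$ over $\mathcal{C}_{n,0}$.
   Context: Plant data: integers $n,m,p\ge 1$, real matrices $A\in\mathbb{R}^{n\times n}$, $B\in\mathbb{R}^{n\times m}$, $C\in\mathbb{R}^{p\times n}$, and symmetric weights $Q\succeq 0$, $W\succeq 0$ ($n\times n$), $R\succ 0$ ($m\times m$), $V\succ 0$ ($p\times p$); $M^{1/2}$ is the symmetric positive semidefinite square root. Standing assumptions: $(A,B)$ and $(A,W^{1/2})$ are controllable, $(C,A)$ and $(Q^{1/2},A)$ are observable. A square matrix is stable if all its eigenvalues have strictly negative real parts. A strictly proper dynamic policy of order $n$ is a matrix $\mathsf{K}=\begin{bmatrix}0 & C_{\mathsf K}\\ B_{\mathsf K} & A_{\mathsf K}\end{bmatrix}$ with $A_{\mathsf K}\in\mathbb{R}^{n\times n}$, $B_{\mathsf K}\in\mathbb{R}^{n\times p}$, $C_{\mathsf K}\in\mathbb{R}^{m\times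 n}$ and zero $m\times p$ upper-left block; $\mathcal{V}_n$ is the vector space of all such matrices. Define $$A_{\mathrm{cl}}(\mathsf K)=\begin{bmatrix}A & BC_{\mathsf K}\\ B_{\mathsf K}C & A_{\mathsf K}\end{bmatrix},\quad B_{\mathrm{cl}}(\mathsf K)=\begin{bmatrix}W^{1/2}&0\\ 0&B_{\mathsf K}V^{1/2}\end{bmatrix},\quad C_{\mathrm{cl}}(\mathsf K)=\begin{bmatrix}Q^{1/2}&0\\ 0&R^{1/2}C_{\mathsf K}\end{bmatrix}.$$ $\mathcal{C}_{n,0}=\{\mathsf K\in\mathcal{V}_n: A_{\mathrm{cl}}(\mathsf K)\text{ is stable}\}$, an open subset of $\mathcal{V}_n$. The LQG cost is $J_{\mathtt{LQG},n}(\mathsf K)=\|\mathbf{T}(\mathsf K,\cdot)\|_{\mathcal{H}_2}$ for $\mathsf K\in\mathcal{C}_{n,0}$, where $\mathbf{T}(\mathsf K,s)=C_{\mathrm{cl}}(\mathsf K)(sI-A_{\mathrm{cl}}(\mathsf K))^{-1}B_{\mathrm{cl}}(\mathsf K)$ and $\|\mathbf{T}\|_{\mathcal{H}_2}^2=\frac{1}{2\pi}\int_{-\infty}^{\infty}\operatorname{tr}(\mathbf{T}(j\omega)^{\mathsf H}\mathbf{T}(j\omega))\,d\omega$. It is real analytic on $\mathcal{C}_{n,0}$; $\nabla J_{\mathtt{LQG},n}$ is the gradient with respect to $(A_{\mathsf K},B_{\mathsf K},C_{\mathsf K})$. A policy $\mathsf K\in\mathcal{C}_{n,0}$ is non-degenerate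 for LQG if, with $\gamma=J_{\mathtt{LQG},n}(\mathsf K)$, there exist a symmetric positive definite $P=\begin{bmatrix}P_{11}&P_{12}\\ P_{12}^{\mathsf T}&P_{22}\end{bmatrix}\in\mathbb{R}^{2n\times 2n}$ (with $n\times n$ blocks) whose block $P_{12}$ is invertible, and a symmetric $\Gamma$, such that $$\begin{bmatrix}A_{\mathrm{cl}}(\mathsf K)^{\mathsf T}P+PA_{\mathrm{cl}}(\mathsf K)&PB_{\mathrm{cl}}(\mathsf K)\\ B_{\mathrm{cl}}(\mathsf K)^{\mathsf T}P&-\gamma I\end{bmatrix}\preceq0,\quad\begin{bmatrix}P&C_{\mathrm{cl}}(\mathsf K)^{\mathsf T}\\ C_{\mathrm{cl}}(\mathsf K)&\Gamma\end{bmatrix}\succeq0,\quad\operatorname{tr}(\Gamma)\le\gamma.$$ *)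

(* Defs.v *)
From mathcomp Require Import all_boot all_order all_algebra.
From mathcomp Require Import all_classical all_reals all_analysis.
From mathcomp Require Import complex.

Set Implicit Arguments.
Unset Strict Implicit.
Unset Printing Implicit Defensive.

Import Order.TTheory GRing.Theory Num.Theory.
Import numFieldNormedType.Exports.

Local Open Scope classical_set_scope.
Local Open Scope ring_scope.

Definition psd (F : realType) k (M : 'M[F]_k) : Prop :=
  M^T = M /\ forall x : 'cV[F]_k, 0 <= (x^T *m M *m x) 0 0.

Definition pd (F : realType) k (M : 'M[F]_k) : Prop :=
  M^T = M /\ forall x : 'cV[F]_k, x != 0 -> 0 < (x^T *m M *m x) 0 0.

(* The unique symmetric positive semidefinite square root when M is positive
   semidefinite; xget returns the default value 0 when there is no such root. *)
Definition sqrtmx (F : realType) k (M : 'M[F]_k) : 'M[F]_k :=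
  xget 0 [set S | psd S /\ S *m S = M].

Definition complex_mx (F : realType) k l (M : 'M[F]_(k, l)) : 'M[F[i]]_(k, l) :=
  map_mx (real_complex F) M.

Definition stable (F : realType) k (M : 'M[F]_k) : Prop :=
  forall z : F[i], eigenvalue (complex_mx M) z -> complex.Re z < 0.

(* [B, A B, ..., A^(n-1) B] has full row rank. *)
Definition controllable (F : realType) n l
    (A : 'M[F]_n) (B : 'M[F]_(n, l)) : Prop :=
  \rank (\mxrow_(i < n) (A ^+ i *m B)) = n.

(* [C; C A; ...; C A^(n-1)] has full column rank. *)
Definition observable (F : realType) n l
    (C : 'M[F]_(l, n)) (A : 'M[F]_n) : Prop :=
  \rank (\mxcol_(i < n) (C *m A ^+ i)) = n.

(* A strictly proper policy is stored as the whole (m + n) x (p + n) matrix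
   [0 C_K; B_K A_K]; membership in V_n is the vanishing of the corner block. *)
Section Policy.
Context {F : realType} {n m p : nat}.
Implicit Type K : 'M[F]_(m + n, p + n).

Definition polA K : 'M[F]_n := drsubmx K.
Definition polB K : 'M[F]_(n, p) := dlsubmx K.
Definition polC K : 'M[F]_(m, n) := ursubmx K.

Definition strictly_proper : set 'M[F]_(m + n, p + n) :=
  [set K | ulsubmx K = 0].

(* The gradient on V_n in the coordinates (A_K, B_K, C_K), as an element of
   V_n: the corner block of K is not a variable. *)
Definition gradient (J : 'M[F]_(m + n, p + n) -> F) K :
    'M[F]_(m + n, p + n) :=
  block_mx
    0 (\matrix_(i, j) 'D_(block_mx 0 (delta_mx i j) 0 0) J K)
    (\matrix_(i, j) 'D_(block_mx 0 0 (delta_mx i j) 0) J K)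
    (\matrix_(i, j) 'D_(block_mx 0 0 0 (delta_mx i j)) J K).

End Policy.

Section ClosedLoop.
Context {F : realType} {n m p : nat}.
Variables (A : 'M[F]_n) (B : 'M[F]_(n, m)) (C : 'M[F]_(p, n)).
Variables (Q W : 'M[F]_n) (R : 'M[F]_m) (V : 'M[F]_p).
Implicit Type K : 'M[F]_(m + n, p + n).

Definition Acl K : 'M[F]_(n + n) :=
  block_mx A (B *m polC K) (polB K *m C) (polA K).

Definition Bcl K : 'M[F]_(n + n, n + p) :=
  block_mx (sqrtmx W) 0 0 (polB K *m sqrtmx V).

Definition Ccl K : 'M[F]_(n + m, n + n) :=
  block_mx (sqrtmx Q) 0 0 (sqrtmx R *m polC K).

Definition stabilizing : set 'M[F]_(m + n, p + n) :=
  [set K | strictly_proper K /\ stable (Acl K)].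

Definition transfer K (s : F[i]) : 'M[F[i]]_(n + m, n + p) :=
  complex_mx (Ccl K) *m invmx (s%:M - complex_mx (Acl K))
    *m complex_mx (Bcl K).

End ClosedLoop.

Definition ctrmx (F : realType) k l (M : 'M[F[i]]_(k, l)) : 'M[F[i]]_(l, k) :=
  (map_mx conjc M)^T.

(* The trace is a nonnegative real element of F[i], so Re only changes its
   type. *)
Definition h2norm (F : realType) k l (T : F[i] -> 'M[F[i]]_(k, l)) : F :=
  Num.sqrt ((2 * pi)^-1 *
    \int[lebesgue_measure]_(w in [set: F])
      complex.Re (\tr (ctrmx (T (Complex 0 w)) *m T (Complex 0 w)))).

Section LQG.
Context {F : realType} {n m p : nat}.
Variables (A : 'M[F]_n) (B : 'M[F]_(n, m)) (C : 'M[F]_(p, n)).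
Variables (Q W : 'M[F]_n) (R : 'M[F]_m) (V : 'M[F]_p).
Implicit Type K : 'M[F]_(m + n, p + n).

Definition lqg_cost K : F := h2norm (transfer A B C Q W R V K).

Definition lqg_nondegenerate K : Prop :=
  let gamma := lqg_cost K in
  let Ak := Acl A B C K in
  let Bk := Bcl W V K in
  let Ck := Ccl Q R K in
  exists (P : 'M[F]_(n + n)) (Gamma : 'M[F]_(n + m)),
    [/\ pd P /\ ursubmx P \in unitmx,
        Gamma^T = Gamma,
        psd (- block_mx (Ak^T *m P + P *m Ak) (P *m Bk)
                        (Bk^T *m P) (- gamma%:M)),
        psd (block_mx P Ck^T Ck Gamma)
      & \tr Gamma <= gamma].

End LQG.

(* Main.v *)
Require Import Defs.
From mathcomp Require Import all_boot all_order all_algebra.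
From mathcomp Require Import all_classical all_reals all_analysis.
From mathcomp Require Import spectral complex ring lra.

Set Implicit Arguments.
Unset Strict Implicit.
Unset Printing Implicit Defensive.

Import Order.TTheory GRing.Theory Num.Theory.
Import numFieldNormedType.Exports.

Local Open Scope classical_set_scope.
Local Open Scope ring_scope.

(** The proof works with the two Gramians of the closed loop (Acl, Bcl, Ccl):
    X, with Acl X + X Acl^T + Bcl Bcl^T = 0, and Y, with
    Acl^T Y + Y Acl + Ccl^T Ccl = 0.

    The squared cost is tr (Ccl X Ccl^T) ([h2_integral]).  On the imaginary
    axis the Lyapunov equation gives G Bcl Bcl^T G^H = X G^H + G X for the
    resolvent G(w) = (iw - Acl)^-1, so the integrand is the real part of a
    linear functional of G.  Such a functional is a combination of powers of
    poles 1/(iw - l) with Re l < 0; only the simple poles contribute, each one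
    pi times its coefficient, and these coefficients add up to the value of the
    functional at the identity.  The same computation shows that X is positive
    semidefinite and that the Lyapunov operator is injective.

    Along a line of policies X is a rational function of the parameter, and an
    exact formula for the difference of two costs ([h2sq_diff]) gives the
    derivative of the cost.  At a stationary policy this yields three matrix
    equations in the n x n blocks of X and Y ([lqg_stationary]).  Minimality of
    the policy and the assumptions on the plant make X and Y positive definite
    ([closed_loop_gramian_pd]), and the equation for A_K then makes X12
    invertible.

    With gamma the cost, P = gamma X^-1 and Gamma = gamma^-1 Ccl X Ccl^T satisfy
    the linear matrix inequalities, and P12 is invertible because X12 is: the
    policy is non-degenerate ([nondegenerate_of_gramian]).

    For global optimality, let Sf and Sc be the Schur complements
    X11 - X12 X22^-1 X21 and Y11 - Y12 Y22^-1 Y21.  Stationarity says that the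
    policy uses the Kalman gain of Sf and the state feedback gain of Sc
    ([stationary_gain]), and the Lyapunov equations then turn into the two
    algebraic Riccati equations ([filter_riccati], and its dual).  For an
    arbitrary stabilizing policy, completing the square with Sc writes the
    squared cost as a constant plus the weighted second moment of H x + C_K xi,
    where x is the state of the plant, xi that of the policy and
    H = R^-1 B^T Sc ([cost_decomposition]); this
    moment is bounded below because X - diag(Sf, 0) is itself a Gramian of the
    closed loop ([error_covariance_bound]).  The bound is attained at the
    stationary policy. *)

(** * Partial fractions on the imaginary axis *)

Section PartialFractions.
Context {F : realType}.
Implicit Types (f g : F -> F[i]) (l a c : F[i]).

Definition pole l (w : F) : F[i] := (Complex 0 w - l)^-1.

(** A function on the imaginary axis together with the sum of its residues,
    which is also the limit of s f(s) at infinity.  Carrying the sum along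
    spares any uniqueness statement about the decomposition. *)
Inductive partial_fraction : (F -> F[i]) -> F[i] -> Prop :=
| PFsimple l : complex.Re l < 0 -> partial_fraction (pole l) 1
| PFmultiple l k : complex.Re l < 0 ->
    partial_fraction (fun w => pole l w ^+ k.+2) 0
| PFadd f g c d : partial_fraction f c -> partial_fraction g d ->
    partial_fraction (fun w => f w + g w) (c + d)
| PFscale a f c : partial_fraction f c ->
    partial_fraction (fun w => a * f w) (a * c).

Lemma PFext f g c d : partial_fraction f c -> f =1 g -> c = d ->
  partial_fraction g d.
Proof. by move=> pf /funext <- <-. Qed.

Lemma imagB_neq0 l w : complex.Re l < 0 -> Complex 0 w - l != 0.
Proof.
case: l => a b /= a0; apply/eqP => -[/eqP]; rewrite sub0r oppr_eq0 => /eqP.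
by move=> a00; rewrite a00 ltxx in a0.
Qed.

(** Multiplying by one more pole makes f decay like s^-2 at infinity, hence the
    residues add up to 0.  For distinct poles, the partial fraction of
    1 / ((s - m) (s - l)) lowers the exponent of the pole m. *)
Lemma PF_power_mul_pole l m k : complex.Re l < 0 -> complex.Re m < 0 ->
  partial_fraction (fun w => pole m w ^+ k.+1 * pole l w) 0.
Proof.
move=> l0 m0; have [<-|lm] := eqVneq l m.
  by apply: PFext (PFmultiple k l0) _ _ => // w; rewrite exprSr.
have ml0 : m - l != 0 by rewrite subr_eq0 eq_sym.
have split1 w : pole m w * pole l w = (m - l)^-1 * (pole m w + - 1 * pole l w).
  by rewrite /pole; field; rewrite ml0 !imagB_neq0.
elim: k => [|k IH].
  apply: PFext (PFscale (m - l)^-1 (PFadd (PFsimple m0)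
    (PFscale (-1) (PFsimple l0)))) _ _ => [w|]; last by rewrite mulr1 subrr mulr0.
  by rewrite /= expr1 split1.
apply: PFext (PFscale (m - l)^-1 (PFadd (PFmultiple k m0) (PFscale (-1) IH))) _ _.
  move=> w /=; rewrite [in RHS]exprSr -mulrA split1.
  by rewrite [_ ^+ k.+2]exprSr; ring.
by rewrite mulr0 addr0 mulr0.
Qed.

Lemma PF_mul_pole l f c : complex.Re l < 0 -> partial_fraction f c ->
  partial_fraction (fun w => f w * pole l w) 0.
Proof.
move=> l0; elim=> {f c}
  [m m0|m k m0|f g c d _ IHf _ IHg|a f c _ IH].
- by apply: PFext (PF_power_mul_pole 0 l0 m0) _ _ => // w; rewrite expr1.
- exact: PF_power_mul_pole.
- by apply: PFext (PFadd IHf IHg) _ _ => [w|]; rewrite ?addr0 // mulrDl.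
- by apply: PFext (PFscale a IH) _ _ => [w|]; rewrite ?mulr0 // mulrA.
Qed.

(** By components, because the primitives below are real functions built from
    the real and imaginary parts. *)
Definition is_cderive (f f' : F -> F[i]) :=
  forall w : F, is_derive w (1 : F) (fun x => complex.Re (f x)) (complex.Re (f' w))
    /\ is_derive w (1 : F) (fun x => complex.Im (f x)) (complex.Im (f' w)).

Lemma ReM (x y : F[i]) : complex.Re (x * y) =
  complex.Re x * complex.Re y - complex.Im x * complex.Im y.
Proof. by case: x y => ? ? []. Qed.
Lemma ImM (x y : F[i]) : complex.Im (x * y) =
  complex.Re x * complex.Im y + complex.Im x * complex.Re y.
Proof. by case: x y => ? ? []. Qed.
Lemma ReD (x y : F[i]) : complex.Re (x + y) = complex.Re x + complex.Re y.
Proof. by case: x y => ? ? []. Qed.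
Lemma ImD (x y : F[i]) : complex.Im (x + y) = complex.Im x + complex.Im y.
Proof. by case: x y => ? ? []. Qed.

Lemma is_cderiveM f f' g g' : is_cderive f f' -> is_cderive g g' ->
  is_cderive (fun w => f w * g w) (fun w => f' w * g w + f w * g' w).
Proof.
move=> df dg w; have [rf jf] := df w; have [rg jg] := dg w; split.
- under eq_fun do rewrite ReM.
  apply: is_derive_eq; rewrite !(ReD, ReM) /GRing.scale /=; ring.
- under eq_fun do rewrite ImM.
  apply: is_derive_eq; rewrite !(ImD, ImM) /GRing.scale /=; ring.
Qed.

Lemma poleE (a b w : F) : a < 0 -> let n := a ^+ 2 + (w - b) ^+ 2 in
  pole (Complex a b) w = Complex (- a / n) (- (w - b) / n).
Proof.
move=> a0 n; rewrite /pole.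
rewrite -[_ - _]/(Complex (0 - a) (w - b)) -[_^-1]/(Complex _ _).
by rewrite !sub0r sqrrN !mulNr.
Qed.

Lemma is_cderive_pole l : complex.Re l < 0 ->
  is_cderive (pole l) (fun w => - (Complex 0 1 : F[i]) * pole l w ^+ 2).
Proof.
case: l => [a b]; rewrite [complex.Re _]/= => a0 w.
have n0 x : a ^+ 2 + (x - b) ^+ 2 != 0.
  by rewrite gt_eqF // ltr_pwDl ?sqr_ge0 // exprn_even_gt0 //= lt_eqF.
split; under eq_fun do rewrite poleE //=.
- apply: is_derive_eq; rewrite poleE // expr2 /= /GRing.scale /=; field.
  by rewrite n0.
- apply: is_derive_eq; rewrite poleE // expr2 /= /GRing.scale /=; field.
  by rewrite n0.
Qed.
End PartialFractions.

(** * Integrals of partial fractions over the real line *)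

Section PrincipalValue.
Context {F : realType}.
Implicit Types (f g : F -> F[i]) (l a c : F[i]).

Lemma inv_quadratic_cvg0 (a : F) : a != 0 ->
  (a ^+ 2 + x ^+ 2)^-1 @[x --> +oo%R] --> (0 : F) /\
  x * (a ^+ 2 + x ^+ 2)^-1 @[x --> +oo%R] --> (0 : F).
Proof.
move=> a0.
have inv0 : x^-1 @[x --> +oo%R] --> (0 : F).
  by apply/gtr0_cvgV0; [exact: nbhs_pinfty_gt | exact: cvg_id].
have n0 x : 0 < a ^+ 2 + x ^+ 2.
  by rewrite ltr_pwDl ?sqr_ge0 // exprn_even_gt0.
split; apply: (squeeze_cvgr _ (cvg_cst 0) inv0).
- near=> x; have x1 : 1 <= x by near: x; apply: nbhs_pinfty_ge; exact: num_real.
  have x0 : 0 < x by exact: lt_le_trans ltr01 x1.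
  rewrite invr_ge0 ltW //= lef_pV2 ?posrE //.
  by rewrite ler_wpDl ?sqr_ge0 // expr2 ler_peMl // ltW.
- near=> x; have x1 : 1 <= x by near: x; apply: nbhs_pinfty_ge; exact: num_real.
  have x0 : 0 < x by exact: lt_le_trans ltr01 x1.
  rewrite mulr_ge0 ?invr_ge0 ?(ltW (n0 x)) ?(ltW x0) //=.
  rewrite ler_pdivrMr // mulrDr [x^-1 * x ^+ 2]mulrA mulVf ?gt_eqF //.
  by rewrite mul1r lerDr mulr_ge0 ?sqr_ge0 ?invr_ge0 ?(ltW x0).
Unshelve. all: by end_near. Qed.

Lemma pole_cvg0 l : complex.Re l < 0 ->
  complex.Re (pole l w) @[w --> +oo%R] --> (0 : F) /\
  complex.Im (pole l w) @[w --> +oo%R] --> (0 : F).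
Proof.
case: l => a b; rewrite [complex.Re _]/= => a0.
have [c1 c2] := inv_quadratic_cvg0 (ltr0_neq0 a0).
have sb := @cvg_addrr F (- b).
have {}c1 := cvg_comp _ _ sb c1; have {}c2 := cvg_comp _ _ sb c2.
split; under eq_fun do rewrite poleE //=.
- rewrite -(mulr0 (- a)); apply: cvgMr; exact: c1.
- by under eq_fun do rewrite mulNr; rewrite -oppr0; apply: cvgN; exact: c2.
Qed.

Lemma pole_exp_cvg0 l k : complex.Re l < 0 ->
  complex.Re (pole l w ^+ k.+1) @[w --> +oo%R] --> (0 : F) /\
  complex.Im (pole l w ^+ k.+1) @[w --> +oo%R] --> (0 : F).
Proof.
move=> l0; have [r0 i0] := pole_cvg0 l0.
elim: k => [|k [IHr IHi]]; first by split; under eq_fun do rewrite expr1.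
split; under eq_fun do rewrite exprS ?ReM ?ImM.
- by have := cvgB (cvgM r0 IHr) (cvgM i0 IHi); rewrite !mulr0 subr0; apply.
- by have := cvgD (cvgM r0 IHi) (cvgM i0 IHr); rewrite !mulr0 addr0; apply.
Qed.

Lemma is_cderive_pole_exp l k : complex.Re l < 0 ->
  is_cderive (fun w => pole l w ^+ k.+1)
    (fun w => - (Complex 0 1 : F[i]) * k.+1%:R * pole l w ^+ k.+2).
Proof.
move=> l0; elim: k => [|k IH].
  have := is_cderive_pole l0; congr is_cderive; apply/funext => w.
  by rewrite mulr1.
have := is_cderiveM (is_cderive_pole l0) IH; congr is_cderive; apply/funext => w.
rewrite /= -[k.+2%:R]natr1 !exprS; set j := Complex 0 1; set K := k.+1%:R.
by set q := _ ^+ k; ring.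
Qed.

Lemma conjc_pole l (w : F) : conjc (pole l w) = pole (conjc l) (- w).
Proof.
rewrite /pole conjc_inv rmorphB /=; congr (_ - _)^-1.
Qed.

Lemma Re_conjc (x : F[i]) : complex.Re (conjc x) = complex.Re x.
Proof. by case: x. Qed.

(** P w is the integral of Re f over [-w, w].  A simple pole is not integrable,
    but its integrals over symmetric intervals converge, because the logarithms
    cancel. *)
Definition symmetric_primitive (f : F -> F[i]) (c : F[i]) (P : F -> F) :=
  [/\ forall w : F, is_derive w (1 : F) P
        (complex.Re (f w) + complex.Re (f (- w))),
      P 0 = 0 & P w @[w --> +oo%R] --> pi * complex.Re c].

(** The two arctangents tend to pi / 2 each, and the difference of the
    logarithms is that of a ratio tending to 1. *)
Lemma simple_pole_primitive l a : complex.Re l < 0 ->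
  exists P, symmetric_primitive (fun w => a * pole l w) (a * 1) P.
Proof.
case: a => u v; case: l => a b; rewrite [complex.Re _]/= => a0.
have n0 x : 0 < a ^+ 2 + x ^+ 2.
  by rewrite ltr_pwDl ?sqr_ge0 // exprn_even_gt0 //= lt_eqF.
have E x : complex.Re (Complex u v * pole (Complex a b) x) =
    (u * (- a) + v * (x - b)) / (a ^+ 2 + (x - b) ^+ 2).
  by rewrite ReM poleE // /complex.Re /complex.Im; ring.
exists (fun w => u * (atan ((w - b) / - a) + atan ((w + b) / - a)) +
  v / 2 * (ln (a ^+ 2 + (w - b) ^+ 2) - ln (a ^+ 2 + (w + b) ^+ 2))); split.
- move=> w; rewrite !E.
  have dln t : is_derive w (1 : F) (fun x => ln (a ^+ 2 + (x + t) ^+ 2))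
      ((a ^+ 2 + (w + t) ^+ 2)^-1 * (2 * (w + t))).
    apply: (@is_derive1_comp _ (@ln F) (fun x => a ^+ 2 + (x + t) ^+ 2)).
      exact: is_derive1_ln.
    by apply: is_derive_eq; rewrite /GRing.scale /=; ring.
  have datan t : is_derive w (1 : F) (fun x => atan ((x + t) / - a))
      ((1 + ((w + t) / - a) ^+ 2)^-1 * (- a)^-1).
    apply: (@is_derive1_comp _ (@atan F) (fun x => (x + t) / - a)).
    by apply: is_derive_eq; rewrite /GRing.scale /=; ring.
  have dm := datan (- b); have lm := dln (- b).
  apply: is_derive_eq; rewrite /GRing.scale /=.
  have n1 := n0 (w - b); have n2 := n0 (w + b).
  field.
  have := n0 (- w - b); have := n0 (w - b).
  by rewrite (ltr0_neq0 a0) => /gt_eqF -> /gt_eqF ->.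
- by rewrite !(sub0r, add0r, sqrrN) subrr mulr0 addr0 mulNr atanN addNr mulr0.
- have [c1 c2] := inv_quadratic_cvg0 (ltr0_neq0 a0).
  have catan t : atan ((w + t) / - a) @[w --> +oo%R] --> pi / 2.
    apply: (cvg_comp _ _ _ (@cvgy_atan F)).
    by apply: gt0_cvgMly; [rewrite invr_gt0 oppr_gt0 | exact: cvg_addrr].
  have cln : ln (a ^+ 2 + (w - b) ^+ 2) - ln (a ^+ 2 + (w + b) ^+ 2)
      @[w --> +oo%R] --> (0 : F).
    have -> : (fun w => ln (a ^+ 2 + (w - b) ^+ 2) - ln (a ^+ 2 + (w + b) ^+ 2)) =
        (fun w => ln (1 - 4 * b * ((w + b) * (a ^+ 2 + (w + b) ^+ 2)^-1) +
          4 * b ^+ 2 * (a ^+ 2 + (w + b) ^+ 2)^-1)).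
      apply/funext => w; rewrite -ln_div ?posrE //; congr ln.
      by field; rewrite gt_eqF.
    rewrite -(ln1 F); apply: continuous_cvg; first exact: continuous_ln.
    have {}c1 := cvg_comp _ _ (@cvg_addrr F b) c1.
    have {}c2 := cvg_comp _ _ (@cvg_addrr F b) c2.
    have := cvgD (cvgB (cvg_cst (1 : F)) (cvgM (cvg_cst (4 * b : F)) c2))
      (cvgM (cvg_cst (4 * b ^+ 2 : F)) c1).
    by rewrite !mulr0 subr0 addr0; apply.
  have := cvgD (cvgM (cvg_cst (u : F)) (cvgD (catan (- b)) (catan b)))
    (cvgM (cvg_cst (v / 2 : F)) cln).
  by rewrite mulr0 addr0 -splitr mulr1 [pi * _]mulrC; apply.
Qed.

(** A higher power of a pole is the derivative of a constant times the next
    lower power, which vanishes at infinity. *)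
Lemma multiple_pole_primitive l k a : complex.Re l < 0 ->
  exists P, symmetric_primitive (fun w => a * pole l w ^+ k.+2) (a * 0) P.
Proof.
move=> l0.
have refl k' z w : complex.Re (z * pole l (- w) ^+ k') =
    complex.Re (conjc z * pole (conjc l) w ^+ k').
  by rewrite -Re_conjc rmorphM rmorphXn /= conjc_pole opprK.
have l0' : complex.Re (conjc l) < 0 by rewrite Re_conjc.
have j2 : Complex 0 1 * Complex 0 1 = -1 :> F[i].
  by rewrite -expr2; exact: sqr_i.
pose j := Complex 0 1 * k.+1%:R^-1 : F[i].
pose p m z := fun w => complex.Re (z * j * pole m w ^+ k.+1).
have dp m z w : complex.Re m < 0 ->
    is_derive w (1 : F) (p m z) (complex.Re (z * pole m w ^+ k.+2)).
  move=> m0; have [d1 d2] := is_cderive_pole_exp k m0 w.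
  rewrite /p; under eq_fun do rewrite ReM; apply: is_derive_eq.
  rewrite /GRing.scale /= -ReM; congr complex.Re.
  rewrite mulrA; congr (_ * _); rewrite /j.
  transitivity (- (Complex 0 1 * Complex 0 1) * z * (k.+1%:R^-1 * k.+1%:R)).
    by ring.
  by rewrite j2 opprK mul1r mulVf ?mulr1 // pnatr_eq0.
have lp m z : complex.Re m < 0 -> p m z w @[w --> +oo%R] --> (0 : F).
  move=> m0; have [c1 c2] := pole_exp_cvg0 k m0.
  rewrite /p; under eq_fun do rewrite ReM.
  have := cvgB (cvgM (cvg_cst (complex.Re (z * j))) c1)
    (cvgM (cvg_cst (complex.Im (z * j))) c2).
  by rewrite !mulr0 subr0; apply.
(* Conjugation replaces the value at - w by one at w, as in [refl]. *)
exists (fun w => p l a w + p (conjc l) (conjc a) w); split=> [w||].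
- have d1 := dp l a w l0; have d2 := dp (conjc l) (conjc a) w l0'.
  by apply: is_derive_eq; rewrite refl.
- have cj : conjc j = - j.
    by rewrite rmorphM fmorphV rmorph_nat /= -mulNr; congr (_ * _); simpc.
  rewrite /p -[X in pole l X]oppr0 refl rmorphM /= cj mulrN mulNr.
  by rewrite -ReD addNr.
- by rewrite !mulr0 -[0](addr0 0); apply: cvgD; apply: lp.
Qed.

(** The factor a lets the induction pass through complex multiples, although
    only a real part is integrated. *)
Lemma PF_symmetric_primitive f c : partial_fraction f c ->
  forall a, exists P, symmetric_primitive (fun w => a * f w) (a * c) P.
Proof.
elim=> {f c} [l l0|l k l0|f g c d _ IHf _ IHg|b f c _ IH] a.
- exact: simple_pole_primitive.
- exact: multiple_pole_primitive.
- have [P [dP P0 lP]] := IHf a; have [Q [dQ Q0 lQ]] := IHg a.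
  exists (fun w => P w + Q w); split=> [w||]; last 2 first.
  + by rewrite P0 Q0 addr0.
  + by rewrite mulrDr ReD mulrDr; apply: cvgD.
  + by apply: is_derive_eq; rewrite !mulrDr !ReD addrACA.
- have [P [dP P0 lP]] := IH (a * b); exists P; split=> // [w|]; last first.
    by rewrite mulrA.
  by rewrite !mulrA.
Qed.

End PrincipalValue.

Section IntegralPF.
Context {F : realType}.
Implicit Types (f g : F -> F[i]) (l a c : F[i]).

Lemma PF_continuous f c : partial_fraction f c ->
  continuous (fun w => complex.Re (f w)) /\ continuous (fun w => complex.Im (f w)).
Proof.
elim=> {f c} [l l0|l k l0|f g c d _ [fr fi] _ [gr gi]|b f c _ [fr fi]].
- have d := is_cderive_pole l0; split=> w; have [dr di] := d w;
  by apply/differentiable_continuous; apply/derivable1_diffP.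
- have d := is_cderive_pole_exp k.+1 l0; split=> w; have [dr di] := d w;
  by apply/differentiable_continuous; apply/derivable1_diffP.
- split=> w; under eq_fun do rewrite ?ReD ?ImD; apply: cvgD;
  solve [exact: fr | exact: fi | exact: gr | exact: gi].
- split=> w; under eq_fun do rewrite ?ReM ?ImM.
  + by apply: cvgB; apply: cvgM; solve [exact: cvg_cst | exact: fr | exact: fi].
  + by apply: cvgD; apply: cvgM; solve [exact: cvg_cst | exact: fr | exact: fi].
Qed.

(** An even integrand is half of its symmetrization, and its sign makes the
    limit of the primitive a Lebesgue integral. *)
Lemma PF_integral f c : partial_fraction f c ->
  (forall w, 0 <= complex.Re (f w)) ->
  (forall w, complex.Re (f (- w)) = complex.Re (f w)) ->
  \int[lebesgue_measure]_(w in [set: F]) complex.Re (f w) = pi * complex.Re c.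
Proof.
move=> pf f0 fe; have [cf _] := PF_continuous pf.
have [P [dP P0 lP]] := PF_symmetric_primitive pf 1.
have dP' (w : F) : is_derive w (1 : F) P (2 * complex.Re (f w)).
  have := dP w; rewrite !mul1r fe; congr is_derive.
  by rewrite mulr2n mulrDl mul1r.
rewrite mul1r in lP.
rewrite /Rintegral ge0_symfun_integralT //=; last by move=> w /=; rewrite fe.
rewrite (_ : [set x | _] = `[0, +oo[%classic); last first.
  by apply/seteqP; split => x/=; rewrite in_itv/= andbT.
rewrite (@ge0_continuous_FTC2y _ _ (fun w => 2^-1 * P w) 0
  (2^-1 * (pi * complex.Re c))).
- by rewrite P0 mulr0 sube0 -EFinM /= mulrA divff ?mul1r.
- by move=> x _; exact: f0.
- by apply: continuous_subspaceT => x; exact: cf.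
- by apply: cvgM; [exact: cvg_cst | exact: lP].
- by move=> x _; have := dP' x; move=> d; apply: derivableM.
- apply: cvg_at_right_filter; apply: cvgM; first exact: cvg_cst.
  have d := dP' 0.
  have cP : {for (0 : F), continuous P}.
    by apply/differentiable_continuous; apply/derivable1_diffP.
  exact: cP.
- move=> x _; rewrite derive1E; have d := dP' x.
  rewrite deriveM // derive_cst derive_val /GRing.scale /=.
  by rewrite mulr0 addr0 mulrA mulVf ?mul1r.
Qed.

End IntegralPF.

(** * Resolvents of stable matrices *)

Section Resolvent.
Context {F : realType}.
Implicit Types (l a c : F[i]).

Definition resolvent n (A : 'M[F]_n) (w : F) : 'M[F[i]]_n :=
  invmx ((Complex 0 w)%:M - complex_mx A).

Lemma stable_unitmx n (A : 'M[F]_n) (s : F[i]) : stable A ->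
  0 <= complex.Re s -> s%:M - complex_mx A \in unitmx.
Proof.
move=> Ast s0; apply: contraLR s0; rewrite -row_free_unit -kermx_eq0 => ker0.
rewrite -ltNge; apply: Ast; apply: contraNN ker0.
rewrite /eigenspace !kermx_eq0 !row_free_unit.
have -> : complex_mx A - s%:M = -1 *: (s%:M - complex_mx A).
  by rewrite scaleN1r opprB.
by rewrite unitmxZ // unitrN1.
Qed.

Lemma imag_unitmx n (A : 'M[F]_n) w : stable A ->
  (Complex 0 w)%:M - complex_mx A \in unitmx.
Proof. by move=> Ast; apply: stable_unitmx. Qed.

Lemma PF0 : partial_fraction (fun=> 0 : F[i]) 0.
Proof.
have l0 : complex.Re (-1 : F[i]) < 0 by rewrite /= ltrN10.
by apply: PFext (PFscale 0 (PFsimple l0)) _ _ => [w|]; rewrite mul0r.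
Qed.

(** Newton expansion of the resolvent: (s - l) G = 1 + (A - l) G, so each l of
    the list splits off one pole, and the expansion ends when the accumulated
    product of the factors A - l is 0. *)
Lemma PF_newton n (A : 'M[F]_n) (ls : seq F[i]) : stable A ->
  {in ls, forall l, complex.Re l < 0} -> forall Y : 'M[F[i]]_n,
  foldl (fun Y l => Y *m (complex_mx A - l%:M)) Y ls = 0 ->
  partial_fraction (fun w => \tr (Y *m resolvent A w)) (\tr Y).
Proof.
move=> Ast; elim: ls => [|l ls IH] lsP Y /= Y0.
  apply: PFext PF0 _ _ => [w|]; last by rewrite Y0 mxtrace0.
  by rewrite Y0 mul0mx mxtrace0.
have l0 : complex.Re l < 0 by rewrite lsP ?mem_head.
have {}IH := IH (fun x xls => lsP x (mem_behead (s := l :: ls) xls)) _ Y0.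
apply: PFext (PFadd (PFscale (\tr Y) (PFsimple l0)) (PF_mul_pole l0 IH)) _ _.
  move=> w; have Gu := imag_unitmx w Ast.
  have E : (Complex 0 w - l) *: (Y *m resolvent A w) =
      Y + Y *m (complex_mx A - l%:M) *m resolvent A w.
    rewrite -{2}(mulmxK Gu Y) -/(resolvent A w) -mulmxDl -mulmxDr.
    by rewrite addrA subrK -raddfB /= mul_mx_scalar scalemxAl.
  have nz := imagB_neq0 w l0.
  apply: (mulfI nz); rewrite -[RHS]mxtraceZ E mxtraceD mulrDr [_ * (_ * pole l w)]mulrCA.
  by rewrite [X in _ + X]mulrCA /pole divff // !mulr1.
by rewrite mulr1 addr0.
Qed.

(** By the Cayley-Hamilton theorem the eigenvalues of A can serve as the list of
    poles. *)
Lemma PF_resolvent n (A : 'M[F]_n) (L : 'M[F[i]]_n) : stable A ->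
  partial_fraction (fun w => \tr (L *m resolvent A w)) (\tr L).
Proof.
move=> Ast; have [ls lsE] := closed_field_poly_normal (char_poly (complex_mx A)).
rewrite (monicP (char_poly_monic _)) scale1r in lsE.
apply: (@PF_newton _ _ ls) => // [l lls|].
  by apply: Ast; rewrite eigenvalue_root_char lsE root_prod_XsubC.
case: n A L Ast lsE => [|n] A L Ast lsE; first by rewrite [LHS]flatmx0.
have -> : forall Y : 'M[F[i]]_n.+1,
    foldl (fun Y l => Y *m (complex_mx A - l%:M)) Y ls =
    Y *m horner_mx (complex_mx A) (\prod_(l <- ls) ('X - l%:P)).
  elim: ls {lsE} => [|l ls IH] Y /=.
    by rewrite big_nil rmorph1 mulmx1.
  by rewrite IH big_cons rmorphM rmorphB /= horner_mx_X horner_mx_C mulmxA.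
by rewrite -lsE Cayley_Hamilton mulmx0.
Qed.

End Resolvent.

(** * The H2 norm and the Lyapunov equation *)

Section H2norm.
Context {F : realType}.

Lemma complex_mxM m n p (M : 'M[F]_(m, n)) (N : 'M[F]_(n, p)) :
  complex_mx (M *m N) = complex_mx M *m complex_mx N.
Proof. exact: map_mxM. Qed.
Lemma complex_mxD m n (M N : 'M[F]_(m, n)) :
  complex_mx (M + N) = complex_mx M + complex_mx N.
Proof. exact: map_mxD. Qed.
Lemma complex_mxT m n (M : 'M[F]_(m, n)) :
  complex_mx M^T = (complex_mx M)^T.
Proof. by rewrite /complex_mx map_trmx. Qed.

Lemma conj_complex_mx m n (M : 'M[F]_(m, n)) :
  map_mx conjc (complex_mx M) = complex_mx M.
Proof. by apply/matrixP => i j; rewrite !mxE conjc_real. Qed.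

Lemma ctrmxM m n p (M : 'M[F[i]]_(m, n)) (N : 'M[F[i]]_(n, p)) :
  ctrmx (M *m N) = ctrmx N *m ctrmx M.
Proof. by rewrite /ctrmx map_mxM trmx_mul. Qed.

Lemma ctrmx_complex m n (M : 'M[F]_(m, n)) :
  ctrmx (complex_mx M) = complex_mx M^T.
Proof. by rewrite /ctrmx conj_complex_mx complex_mxT. Qed.

Lemma ctrmxK m n : cancel (@ctrmx F m n) (@ctrmx F n m).
Proof. by move=> M; apply/matrixP => i j; rewrite !mxE conjcK. Qed.

Lemma tr_ctrmx n (M : 'M[F[i]]_n) : \tr (ctrmx M) = conjc (\tr M).
Proof. by rewrite /ctrmx mxtrace_tr trace_map_mx. Qed.

Lemma Re_tr_ctrmx_ge0 m n (M : 'M[F[i]]_(m, n)) :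
  0 <= complex.Re (\tr (ctrmx M *m M)).
Proof.
rewrite /mxtrace (big_morph (@complex.Re F) (@ReD F) (erefl _)).
apply: sumr_ge0 => i _; rewrite mxE.
rewrite (big_morph (@complex.Re F) (@ReD F) (erefl _)).
apply: sumr_ge0 => j _; rewrite !mxE ReM; case: (M j i) => a b /=.
by rewrite mulNr opprK addr_ge0 // -expr2 sqr_ge0.
Qed.

Lemma conj_resolvent n (A : 'M[F]_n) w :
  map_mx conjc (resolvent A w) = resolvent A (- w).
Proof.
rewrite /resolvent map_invmx; congr invmx.
by rewrite map_mxB conj_complex_mx map_scalar_mx.
Qed.

(** With D = iw - A the Lyapunov equation reads B B^T = D X + X D^H, because the
    two terms iw X cancel; multiply by G = D^-1 on the left and by G^H on the
    right. *)
Lemma resolvent_lyapunov n m (A X : 'M[F]_n) (B : 'M[F]_(n, m)) w :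
  stable A -> A *m X + X *m A^T + B *m B^T = 0 ->
  let G := resolvent A w in
  G *m complex_mx (B *m B^T) *m ctrmx G =
  complex_mx X *m ctrmx G + G *m complex_mx X.
Proof.
move=> Ast lyap G; have Gu := imag_unitmx w Ast.
set D := _ - _ in Gu; have GE : G = invmx D by [].
have -> : B *m B^T = - (A *m X + X *m A^T).
  by apply/eqP; rewrite -addr_eq0 addrC lyap.
have DE : ctrmx D = - (Complex 0 w)%:M - complex_mx A^T.
  rewrite /ctrmx map_mxB conj_complex_mx linearB /= -complex_mxT.
  rewrite map_scalar_mx tr_scalar_mx; congr (_ - _).
  by rewrite -scalemx1 -[in RHS]scalemx1 -scaleNr; congr (_ *: _); simpc.
have Du : ctrmx D \in unitmx by rewrite /ctrmx unitmx_tr map_unitmx.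
have cG : ctrmx G = invmx (ctrmx D).
  by rewrite GE /ctrmx -trmx_inv -map_invmx.
have -> : complex_mx (- (A *m X + X *m A^T)) =
    D *m complex_mx X + complex_mx X *m ctrmx D.
  rewrite DE mulmxBr mulmxBl mulmxN mul_mx_scalar mul_scalar_mx.
  rewrite addrACA subrr add0r -opprD -!complex_mxM -complex_mxD.
  exact: map_mxN.
rewrite mulmxDr mulmxDl cG mulmxA GE mulVmx // mul1mx; congr (_ + _).
by rewrite -!mulmxA mulmxV // mulmx1.
Qed.

Section Formula.
Variables (n m p : nat) (A X : 'M[F]_n) (B : 'M[F]_(n, m)) (C : 'M[F]_(p, n)).
Hypothesis Ast : stable A.
Hypothesis lyap : A *m X + X *m A^T + B *m B^T = 0.

Let T w := complex_mx C *m resolvent A w *m complex_mx B.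
Let L := (X + X^T) *m (C^T *m C).

(** The adjoint of X G^H is G X^T, so the real parts of both terms of
    [resolvent_lyapunov] are linear functionals of G. *)
Lemma h2_integrand w : complex.Re (\tr (ctrmx (T w) *m T w)) =
  complex.Re (\tr (complex_mx L *m resolvent A w)).
Proof.
have -> : \tr (ctrmx (T w) *m T w) = \tr (complex_mx C *m
    (complex_mx X *m ctrmx (resolvent A w) + resolvent A w *m complex_mx X)
    *m complex_mx C^T).
  rewrite mxtrace_mulC -(resolvent_lyapunov w Ast lyap) /T !ctrmxM !ctrmx_complex.
  by rewrite complex_mxM !mulmxA.
set G := resolvent A w; rewrite mulmxDr mulmxDl mxtraceD ReD.
have -> : \tr (complex_mx C *m (complex_mx X *m ctrmx G) *m complex_mx C^T) =
   conjc (\tr (complex_mx (X^T *m (C^T *m C)) *m G)).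
  rewrite -tr_ctrmx ctrmxM ctrmx_complex !trmx_mul !trmxK !complex_mxM.
  by rewrite mxtrace_mulC [RHS]mxtrace_mulC !mulmxA.
rewrite Re_conjc addrC -ReD; congr complex.Re.
rewrite /L mulmxDl complex_mxD mulmxDl mxtraceD; congr (_ + _).
rewrite !complex_mxM [LHS]mxtrace_mulC !mulmxA.
by rewrite [LHS]mxtrace_mulC !mulmxA.
Qed.

Lemma h2_integral : (2 * pi)^-1 * \int[lebesgue_measure]_(w in [set: F])
    complex.Re (\tr (ctrmx (T w) *m T w)) = \tr (C *m X *m C^T).
Proof.
under eq_Rintegral do rewrite h2_integrand.
rewrite (PF_integral (PF_resolvent _ Ast)); last 2 first.
- by move=> w; rewrite -h2_integrand Re_tr_ctrmx_ge0.
- move=> w; rewrite -conj_resolvent -[complex_mx L]conj_complex_mx.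
  by rewrite -map_mxM trace_map_mx Re_conjc conj_complex_mx.
have -> : \tr (complex_mx L) = real_complex F (\tr L) by exact: trace_map_mx.
have -> : \tr L = 2 * \tr (C *m X *m C^T).
  rewrite /L mulmxDl mxtraceD -[\tr (X^T *m _)]mxtrace_tr !trmx_mul !trmxK.
  rewrite -[C *m X *m _]mulmxA [\tr (C *m _)]mxtrace_mulC !mulmxA.
  by rewrite [\tr (C^T *m _ *m _)]mxtrace_mulC mulmxA -mulr2n mulr_natl.
have pi0 : pi != 0 :> F by rewrite gt_eqF ?pi_gt0.
by rewrite [complex.Re _]/=; move: (@pi F) pi0 => q q0; field.
Qed.

End Formula.

Lemma h2normE n m p (A X : 'M[F]_n) (B : 'M[F]_(n, m)) (C : 'M[F]_(p, n)) :
  stable A -> A *m X + X *m A^T + B *m B^T = 0 ->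
  h2norm (fun s => complex_mx C *m invmx (s%:M - complex_mx A) *m complex_mx B)
    = Num.sqrt (\tr (C *m X *m C^T)).
Proof. by move=> Ast lyap; rewrite /h2norm (h2_integral C Ast lyap). Qed.

(** By [h2_integral] the trace is an integral of squared norms.  With C a row
    this is the semidefiniteness of X. *)
Lemma tr_gram_ge0 n m p (A X : 'M[F]_n) (B : 'M[F]_(n, m)) (C : 'M[F]_(p, n)) :
  stable A -> A *m X + X *m A^T + B *m B^T = 0 -> 0 <= \tr (C *m X *m C^T).
Proof.
move=> Ast lyap; rewrite -(h2_integral C Ast lyap).
rewrite mulr_ge0 ?invr_ge0 ?mulr_ge0 ?pi_ge0 //.
by apply: Rintegral_ge0 => w _; exact: Re_tr_ctrmx_ge0.
Qed.

(** For a solution X of the homogeneous equation, [resolvent_lyapunov] gives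
    X G^H + G X = 0, so the trace of (X^T X + X X^T) G has zero real part on the
    imaginary axis.  Its symmetric primitive is then constant, and its limit
    pi tr (X^T X + X X^T) is 0. *)
Lemma lyapunov_inj n (A X : 'M[F]_n) :
  stable A -> A *m X + X *m A^T = 0 -> X = 0.
Proof.
move=> Ast lyap.
have [P [dP P0 lP]] := PF_symmetric_primitive
  (PF_resolvent (complex_mx (X^T *m X + X *m X^T)) Ast) 1.
have trE : \tr (complex_mx (X^T *m X + X *m X^T)) =
  real_complex F (2 * \tr (X *m X^T)).
  by rewrite [LHS]trace_map_mx mxtraceD mxtrace_mulC -mulr2n mulr_natl.
have ReG w : complex.Re (\tr (complex_mx (X^T *m X + X *m X^T) *m resolvent A w)) = 0.
  have := @resolvent_lyapunov n 0 A X 0 w Ast.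
  rewrite mul0mx addr0 => /(_ lyap) /=.
  rewrite {1}/complex_mx map_mx0 mulmx0 mul0mx.
  set G := resolvent A w => E.
  have -> : \tr (complex_mx (X^T *m X + X *m X^T) *m G) =
     conjc (\tr (complex_mx X *m ctrmx G *m complex_mx X^T))
     + \tr (G *m complex_mx X *m complex_mx X^T).
    rewrite -tr_ctrmx !ctrmxM ctrmxK !ctrmx_complex trmxK complex_mxD mulmxDl mxtraceD.
    congr (_ + _); first by rewrite complex_mxM -mulmxA mxtrace_mulC !mulmxA.
    by rewrite complex_mxM mxtrace_mulC !mulmxA.
  rewrite ReD Re_conjc -ReD -mxtraceD -mulmxDl -E mul0mx mxtrace0.
  by [].
have P1 w : P w = 0.
  rewrite -P0; apply: is_derive_0_is_cst => x.
  by have := dP x; rewrite !mul1r !ReG addr0.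
have : P w @[w --> +oo%R] --> (0 : F).
  by rewrite (_ : P = cst 0); [exact: cvg_cst | apply/funext => w; rewrite P1].
move=> /(cvg_unique _ lP); rewrite mul1r trE [complex.Re _]/= => X0'.
have X0 : \tr (X *m X^T) = 0.
  have : pi * (2 * \tr (X *m X^T)) = 0 :> F by exact: X0'.
  move/eqP; rewrite !mulf_eq0 gt_eqF ?pi_gt0 //=.
  by rewrite pnatr_eq0 => /eqP.
apply/matrixP => i j; rewrite mxE; apply/eqP; rewrite -sqrf_eq0; apply/eqP.
have sq k : 0 <= (X *m X^T) k k.
  by rewrite mxE sumr_ge0 // => l _; rewrite mxE -expr2 sqr_ge0.
have /psumr_eq0P := X0 => /(_ (fun k _ => sq k)) /(_ i isT).
rewrite mxE => /psumr_eq0P {}X0'; have := X0' _ j isT.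
by rewrite mxE -expr2; apply=> k _; rewrite mxE -expr2 sqr_ge0.
Qed.

End H2norm.

(** * Quadratic forms, Gramians and Lyapunov stability *)

Section Lyapunov.
Context {F : realType}.

Lemma eigenvalue_trmx n (A : 'M[F[i]]_n) z : eigenvalue A^T z = eigenvalue A z.
Proof.
rewrite /eigenvalue /eigenspace !kermx_eq0 !row_free_unit.
by rewrite -(unitmx_tr (A - _)) linearB /= tr_scalar_mx.
Qed.

Lemma stable_trmx n (A : 'M[F]_n) : stable A -> stable A^T.
Proof. by move=> Ast z; rewrite complex_mxT eigenvalue_trmx; exact: Ast. Qed.

Definition quad n (M : 'M[F]_n) (x : 'cV[F]_n) : F := (x^T *m M *m x) 0 0.

Lemma quadD n (M N : 'M[F]_n) x : quad (M + N) x = quad M x + quad N x.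
Proof. by rewrite /quad mulmxDr mulmxDl mxE. Qed.
Lemma quadN n (M : 'M[F]_n) x : quad (- M) x = - quad M x.
Proof. by rewrite /quad mulmxN mulNmx mxE. Qed.
Lemma quadZ n a (M : 'M[F]_n) x : quad (a *: M) x = a * quad M x.
Proof. by rewrite /quad -scalemxAr -scalemxAl mxE. Qed.
Lemma quadE n (M : 'M[F]_n) x : quad M x = \tr (x^T *m M *m x).
Proof. by rewrite /quad /mxtrace big_ord1. Qed.
Lemma quad_trmx n (M : 'M[F]_n) x : quad M^T x = quad M x.
Proof. by rewrite !quadE -mxtrace_tr !trmx_mul !trmxK mulmxA. Qed.
Lemma bilin_sym n (M : 'M[F]_n) (x y : 'cV[F]_n) : M^T = M ->
  (y^T *m M *m x) 0 0 = (x^T *m M *m y) 0 0.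
Proof.
move=> Ms; have E (N : 'M[F]_1) : N^T 0 0 = N 0 0 by rewrite mxE.
by rewrite -E !trmx_mul trmxK Ms mulmxA.
Qed.
Lemma quad_congr n m (M : 'M[F]_n) (N : 'M[F]_(m, n)) x :
  quad (N *m M *m N^T) x = quad M (N^T *m x).
Proof. by rewrite /quad trmx_mul trmxK !mulmxA. Qed.

Lemma quad1 n (x : 'cV[F]_n) : quad 1%:M x = \sum_i x i 0 ^+ 2.
Proof.
by rewrite /quad mulmx1 mxE; apply: eq_bigr => i _; rewrite mxE expr2.
Qed.
Lemma quad1_ge0 n (x : 'cV[F]_n) : 0 <= quad 1%:M x.
Proof. by rewrite quad1 sumr_ge0 // => i _; rewrite sqr_ge0. Qed.
Lemma quad1_eq0 n (x : 'cV[F]_n) : quad 1%:M x = 0 -> x = 0.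
Proof.
rewrite quad1 => /psumr_eq0P x0; apply/matrixP => i j; rewrite ord1 mxE.
by apply/eqP; rewrite -sqrf_eq0 x0 // => k _; rewrite sqr_ge0.
Qed.
Lemma quad_gram n m (B : 'M[F]_(n, m)) x : quad (B *m B^T) x = quad 1%:M (B^T *m x).
Proof. by rewrite -quad_congr mulmx1. Qed.

Lemma psd_gram n m (B : 'M[F]_(n, m)) : psd (B *m B^T).
Proof.
split=> [|x]; first by rewrite trmx_mul trmxK.
by rewrite -/(quad _ x) quad_gram quad1_ge0.
Qed.

Lemma psd_congr n m (M : 'M[F]_n) (N : 'M[F]_(m, n)) : psd M ->
  psd (N *m M *m N^T).
Proof.
move=> [Ms M0]; split=> [|x]; first by rewrite !trmx_mul trmxK Ms mulmxA.
by rewrite -/(quad _ x) quad_congr; exact: M0.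
Qed.

Lemma psdZ n a (M : 'M[F]_n) : 0 <= a -> psd M -> psd (a *: M).
Proof.
move=> a0 [Ms M0]; split=> [|x]; first by rewrite linearZ /= Ms.
by rewrite -/(quad _ x) quadZ mulr_ge0 //; exact: M0.
Qed.

(** Cauchy-Schwarz for a semidefinite form: at t = - a / (a + c) the polynomial
    t |-> quad M (x + t M x) = 2 t a + t^2 c is negative unless a = |M x|^2 is
    0. *)
Lemma psd_quad_eq0 n (M : 'M[F]_n) x : psd M -> quad M x = 0 -> M *m x = 0.
Proof.
move=> [Ms M0] Mx0; apply: quad1_eq0; apply/eqP; rewrite eq_le quad1_ge0 andbT.
set y := M *m x; set a := quad 1%:M y.
have a0 : 0 <= a by exact: quad1_ge0.
have [//|ap] := lerP a 0.
set c := quad M y; have c0 : 0 <= c by exact: M0.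
have E t : quad M (x + t *: y) = 2 * t * a + t ^+ 2 * c.
  have xy : (x^T *m M *m y) 0 0 = a by rewrite /a /quad mulmx1 /y trmx_mul Ms.
  have yx : (y^T *m M *m x) 0 0 = a.
    by rewrite /a /quad mulmx1 -[in RHS]/y -mulmxA.
  have -> : quad M (x + t *: y) = quad M x + t * (x^T *m M *m y) 0 0 +
      t * (y^T *m M *m x) 0 0 + t ^+ 2 * c.
    have tr : (x + t *: y)^T = x^T + t *: y^T by rewrite linearD linearZ.
    have e (N : 'M[F]_1) : N 0 0 = \tr N by rewrite /mxtrace big_ord1.
    rewrite /c /quad tr !mulmxDl !mulmxDr -!scalemxAl -!scalemxAr !scalerA.
    by rewrite !e !mxtraceD !mxtraceZ; ring.
  by rewrite xy yx Mx0; ring.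
have := M0 (x + (- (a / (a + c))) *: y); rewrite -/(quad _ _) E.
have ac : 0 < a + c by rewrite ltr_wpDr.
suff -> : 2 * - (a / (a + c)) * a + (- (a / (a + c))) ^+ 2 * c =
   - (a ^+ 2 / (a + c)) * (1 + a / (a + c)).
  rewrite leNgt nmulr_rlt0 ?oppr_lt0 ?divr_gt0 ?exprn_gt0 //.
  by rewrite addr_gt0 ?divr_gt0.
by field; rewrite gt_eqF.
Qed.

Lemma psd_ker0_pd n (M : 'M[F]_n) : psd M -> (forall x : 'cV[F]_n, M *m x = 0 -> x = 0) ->
  pd M.
Proof.
move=> Mp ker; split; first by case: Mp.
move=> x x0; rewrite lt_def; case: (Mp) => _ -> ; rewrite andbT.
by apply: contraNneq x0 => /psd_quad_eq0 Mx; apply/eqP/ker/Mx.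
Qed.

Lemma pd_psd n (M : 'M[F]_n) : pd M -> psd M.
Proof.
move=> [Ms M0]; split=> // x; have [->|/M0/ltW //] := eqVneq x 0.
by rewrite mulmx0 mxE.
Qed.

Lemma pd_ker0 n (M : 'M[F]_n) (x : 'cV[F]_n) : pd M -> M *m x = 0 -> x = 0.
Proof.
move=> [_ M0] Mx; apply/eqP; apply: contraT => /M0.
by rewrite -mulmxA Mx mulmx0 mxE ltxx.
Qed.

Lemma ker0_unitmx n (M : 'M[F]_n) : (forall x : 'cV[F]_n, M *m x = 0 -> x = 0) ->
  M \in unitmx.
Proof.
move=> ker; rewrite -unitmx_tr -row_free_unit; apply: inj_row_free => v.
move/(congr1 trmx); rewrite trmx_mul trmxK trmx0 => /ker /(congr1 trmx).
by rewrite trmxK trmx0.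
Qed.

Lemma pd_unitmx n (M : 'M[F]_n) : pd M -> M \in unitmx.
Proof. by move=> Mp; apply: ker0_unitmx => x; exact: pd_ker0. Qed.

(** The matrix of X |-> A X + X A^T on vectorized matrices. *)
Definition lyap_mx n (A : 'M[F]_n) : 'M[F]_(n * n) := lin_mulmx A + lin_mulmxr A^T.

Lemma lyap_mxE n (A X : 'M[F]_n) :
  mxvec X *m lyap_mx A = mxvec (A *m X + X *m A^T).
Proof. by rewrite mulmxDr !mul_vec_lin linearD. Qed.

Lemma lyap_mx_unit n (A : 'M[F]_n) : stable A -> lyap_mx A \in unitmx.
Proof.
move=> Ast; rewrite -row_free_unit; apply: inj_row_free => v.
rewrite -[v]vec_mxK lyap_mxE => /(congr1 vec_mx); rewrite mxvecK linear0.
by move/(lyapunov_inj Ast) => ->; rewrite linear0.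
Qed.

(** The solution of A X + X A^T + M = 0, see [gramianP]; it is given by the
    inverse of a matrix depending linearly on A, which is what
    [gramian_cvg] exploits. *)
Definition gramian n (A M : 'M[F]_n) : 'M[F]_n :=
  vec_mx (mxvec (- M) *m invmx (lyap_mx A)).

Lemma gramianP n (A M : 'M[F]_n) : stable A ->
  A *m gramian A M + gramian A M *m A^T + M = 0.
Proof.
move=> Ast; have := lyap_mxE A (gramian A M).
rewrite vec_mxK mulmxKV ?lyap_mx_unit // => /(can_inj mxvecK) <-.
by rewrite addNr.
Qed.

Lemma gramian_uniq n (A M X : 'M[F]_n) : stable A ->
  A *m X + X *m A^T + M = 0 -> X = gramian A M.
Proof.
move=> Ast eX; apply/eqP; rewrite -subr_eq0; apply/eqP; apply: (lyapunov_inj Ast).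
rewrite mulmxBr mulmxBl addrACA -opprD.
have := gramianP M Ast => eG; rewrite -(addrK M (_ + X *m _)) eX sub0r.
by rewrite -(addrK M (_ + gramian _ _ *m _)) eG sub0r opprK addNr.
Qed.

Lemma gramian_sym n (A M : 'M[F]_n) : stable A -> M^T = M ->
  (gramian A M)^T = gramian A M.
Proof.
move=> Ast Ms; apply: gramian_uniq => //.
have := congr1 trmx (gramianP M Ast); rewrite !linearD /= !trmx_mul trmxK Ms trmx0.
by rewrite [_ *m A^T + _]addrC.
Qed.

Lemma gramian_psd n m (A : 'M[F]_n) (B : 'M[F]_(n, m)) : stable A ->
  psd (gramian A (B *m B^T)).
Proof.
move=> Ast; split=> [|x]; first by rewrite gramian_sym // trmx_mul trmxK.
rewrite -/(quad _ x) quadE -{2}[x]trmxK.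
exact: tr_gram_ge0 Ast (gramianP _ Ast).
Qed.

(** Evaluate the Lyapunov equation as a quadratic form at x, then apply it
    to x.  Together with [controllable_inv] this makes the Gramian of a
    controllable pair definite. *)
Lemma gramian_ker n m (A : 'M[F]_n) (B : 'M[F]_(n, m)) (x : 'cV[F]_n) : stable A ->
  gramian A (B *m B^T) *m x = 0 ->
  B^T *m x = 0 /\ gramian A (B *m B^T) *m (A^T *m x) = 0.
Proof.
move=> Ast Gx; have := gramianP (B *m B^T) Ast; set G := gramian _ _ in Gx *.
have [Gs _] := gramian_psd B Ast; rewrite -/G in Gs => eG.
have xG : x^T *m G = 0 by rewrite -[LHS]trmxK trmx_mul trmxK Gs Gx trmx0.
have Bx : B^T *m x = 0.
  apply: quad1_eq0; rewrite -quad_gram.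
  have := congr1 (fun M => quad M x) eG; rewrite !quadD [RHS]/quad mulmx0 mul0mx [RHS]mxE.
  rewrite {1 2}/quad -[x^T *m (A *m G) *m x]mulmxA -[A *m G *m x]mulmxA Gx !mulmx0 mxE.
  by rewrite mulmxA xG !mul0mx mxE !add0r.
split=> //; have := congr1 (mulmx^~ x) eG; rewrite /= mul0mx !mulmxDl.
by rewrite -!mulmxA Gx Bx !mulmx0 add0r addr0.
Qed.

(** For a left eigenvector a + ib of A with eigenvalue z, the form of
    A P + P A^T at a plus that at b is 2 Re z (a^T P a + b^T P b); the terms in
    Im z cancel by symmetry of P. *)
Lemma lyapunov_direct n (A P : 'M[F]_n) : pd P ->
  (forall x, x != 0 -> quad (A *m P + P *m A^T) x < 0) -> stable A.
Proof.
move=> Pp neg z /eigenvalueP[v vA v0].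
pose a : 'cV[F]_n := (map_mx (@complex.Re F) v)^T.
pose b : 'cV[F]_n := (map_mx (@complex.Im F) v)^T.
have Ea : a^T *m A = complex.Re z *: a^T - complex.Im z *: b^T.
  rewrite !trmxK; apply/rowP => j; have := congr1 (fun u : 'rV_n => complex.Re (u 0 j)) vA.
  rewrite !mxE ReM (big_morph (@complex.Re F) (@ReD F) (erefl _)) => <-.
  by apply: eq_bigr => k _; rewrite !mxE ReM /= mulr0 subr0.
have Eb : b^T *m A = complex.Im z *: a^T + complex.Re z *: b^T.
  rewrite !trmxK; apply/rowP => j; have := congr1 (fun u : 'rV_n => complex.Im (u 0 j)) vA.
  rewrite !mxE ImM (big_morph (@complex.Im F) (@ImD F) (erefl _)) addrC => <-.
  by apply: eq_bigr => k _; rewrite !mxE ImM /= mulr0 add0r.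
have [Ps P0] := Pp.
have ab0 : (a != 0) || (b != 0).
  rewrite -negb_and; apply: contra v0 => /andP[/eqP a0 /eqP b0].
  apply/eqP/rowP => j; rewrite mxE.
  have := congr1 (fun u : 'cV_n => u j 0) a0; have := congr1 (fun u : 'cV_n => u j 0) b0.
  by rewrite !mxE; case: (v 0 j) => ? ? /= -> ->.
have quad2 x : quad (A *m P + P *m A^T) x = 2 * (x^T *m A *m P *m x) 0 0.
  rewrite quadD -[quad (P *m _) x]quad_trmx trmx_mul trmxK Ps -mulr2n mulr_natl.
  by rewrite /quad !mulmxA.
have sum : quad (A *m P + P *m A^T) a + quad (A *m P + P *m A^T) b =
  2 * complex.Re z * (quad P a + quad P b).
  rewrite !quad2 Ea Eb !mulmxBl !mulmxDl -!scalemxAl.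
  have ba : (b^T *m P *m a) 0 0 = (a^T *m P *m b) 0 0.
    exact: bilin_sym.
  move: ba; rewrite /quad !mxE => ->; ring.
have neg0 x : quad (A *m P + P *m A^T) x <= 0.
  have [->|/neg/ltW //] := eqVneq x 0.
  by rewrite /quad mulmx0 mxE.
have pos0 x : 0 <= quad P x by case: (pd_psd Pp) => _; apply.
have lhs : quad (A *m P + P *m A^T) a + quad (A *m P + P *m A^T) b < 0.
  case/orP: ab0 => [/neg a0|/neg b0]; [exact: ltr_wnDr | exact: ltr_wnDl].
rewrite sum in lhs; rewrite ltNge; apply/negP => z0.
by move: lhs; rewrite ltNge mulr_ge0 ?mulr_ge0 ?addr_ge0.
Qed.

End Lyapunov.

(** * Perturbation of stable systems *)

Section Perturbation.
Context {F : realType}.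

Lemma quad_bound n (E : 'M[F]_n) x :
  quad E x <= (\sum_i \sum_j `|E i j|) * quad 1%:M x.
Proof.
have sq i : x i 0 ^+ 2 <= quad 1%:M x.
  rewrite quad1 (bigD1 i) //= lerDl sumr_ge0 // => j _; exact: sqr_ge0.
have -> : quad E x = \sum_i \sum_j E i j * (x i 0 * x j 0).
  rewrite /quad mxE exchange_big /=; apply: eq_bigr => j _.
  rewrite mxE big_distrl /=; apply: eq_bigr => i _; rewrite mxE; ring.
rewrite big_distrl /=; apply: ler_sum => i _.
rewrite big_distrl /=; apply: ler_sum => j _.
apply: le_trans (ler_norm _) _; rewrite normrM ler_wpM2l //.
have := sq i; have := sq j; have := sqr_ge0 (x i 0 - x j 0).
have := sqr_ge0 (x i 0 + x j 0); rewrite ler_norml => h1 h2 h3 h4.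
apply/andP; split; nra.
Qed.

(** The Lyapunov certificate of A0 with right-hand side - 1 remains one for
    nearby matrices. *)
Lemma near_stable n (A0 A1 : 'M[F]_n) : stable A0 ->
  \forall h \near (0 : F), stable (A0 + h *: A1).
Proof.
move=> Ast; pose P := gramian A0 (1%:M *m 1%:M^T).
have Pp : pd P.
  apply: psd_ker0_pd; first exact: gramian_psd.
  by move=> x /(gramian_ker Ast)[]; rewrite trmx1 mul1mx.
have eP : A0 *m P + P *m A0^T = - 1%:M.
  have := gramianP (1%:M *m 1%:M^T) Ast; rewrite -/P => /eqP.
  by rewrite addr_eq0 trmx1 mul1mx => /eqP.
pose E := A1 *m P + P *m A1^T.
pose c : F := \sum_i \sum_j `|E i j| + \sum_i \sum_j `|(- E) i j| + 1.
have c0 : 0 < c by rewrite ltr_wpDl // addr_ge0 // !sumr_ge0 // => i _; rewrite sumr_ge0.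
have ci0 : 0 < c^-1 by rewrite invr_gt0.
have near_h : \forall h \near (0 : F), `|h| < c^-1 by exact: nbhs0_lt.
near=> h.
apply: (lyapunov_direct Pp) => x x0.
have -> : (A0 + h *: A1) *m P + P *m (A0 + h *: A1)^T = - 1%:M + h *: E.
  rewrite linearD linearZ /= mulmxDl mulmxDr addrACA eP; congr (_ + _).
  by rewrite /E scalerDr -scalemxAl -scalemxAr.
have q0 : 0 < quad 1%:M x.
  rewrite lt_def quad1_ge0 andbT; apply: contraNneq x0 => /quad1_eq0 ->//.
have hc : `|h| < c^-1 by near: h.
rewrite quadD quadN quadZ addrC subr_lt0.
have bound : `|quad E x| <= c * quad 1%:M x.
  have b1 := quad_bound E x; have b2 := quad_bound (- E) x; rewrite quadN in b2.
  have s1 : 0 <= (\sum_i \sum_j `|E i j|) * quad 1%:M x.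
    by rewrite mulr_ge0 ?(ltW q0) // sumr_ge0 // => i _; rewrite sumr_ge0.
  have s2 : 0 <= (\sum_i \sum_j `|(- E) i j|) * quad 1%:M x.
    by rewrite mulr_ge0 ?(ltW q0) // sumr_ge0 // => i _; rewrite sumr_ge0.
  by rewrite ler_norml /c; apply/andP; split; lra.
apply: le_lt_trans (ler_norm _) _; rewrite normrM.
apply: le_lt_trans (ler_wpM2l (normr_ge0 h) bound) _.
by rewrite mulrA gtr_pMl // -ltr_pdivlMr // div1r.
Unshelve. all: by end_near. Qed.

Lemma lyap_mx_line n (A0 A1 : 'M[F]_n) h :
  lyap_mx (A0 + h *: A1) = lyap_mx A0 + h *: lyap_mx A1.
Proof.
rewrite /lyap_mx [(_ + _)^T]linearD /= [(h *: _)^T]linearZ /=.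
by rewrite !linearD !linearZ /= addrACA -scalerDr.
Qed.

(** By Cramer's rule the entries of the Gramian are quotients of polynomials in
    h, and the denominator, the determinant of the Lyapunov operator, does not
    vanish at 0. *)
Lemma gramian_cvg n (A0 A1 M0 M1 M2 : 'M[F]_n) i j : stable A0 ->
  gramian (A0 + h *: A1) (M0 + h *: M1 + h ^+ 2 *: M2) i j @[h --> (0 : F)]
  --> gramian A0 M0 i j.
Proof.
move=> Ast.
pose S := map_mx polyC (lyap_mx A0) + 'X *: map_mx polyC (lyap_mx A1).
pose b := map_mx polyC (mxvec (- M0)) + 'X *: map_mx polyC (mxvec (- M1))
  + 'X ^+ 2 *: map_mx polyC (mxvec (- M2)).
have hC m1 m2 (M : 'M[F]_(m1, m2)) h : map_mx (horner_eval h) (map_mx polyC M) = M.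
  by apply/matrixP => k l; rewrite !mxE /horner_eval hornerC.
have hX h : horner_eval h 'X = h by rewrite /horner_eval hornerX.
have Sh h : map_mx (horner_eval h) S = lyap_mx (A0 + h *: A1).
  by rewrite lyap_mx_line map_mxD map_mxZ !hC /= hX.
have bh h : map_mx (horner_eval h) b = mxvec (- (M0 + h *: M1 + h ^+ 2 *: M2)).
  rewrite !map_mxD !map_mxZ !hC rmorphXn /= hX.
  by rewrite !opprD -!scalerN !linearD !linearZ.
pose num : {poly F} := vec_mx (b *m \adj S) i j.
pose den : {poly F} := \det S.
have E h : stable (A0 + h *: A1) ->
    gramian (A0 + h *: A1) (M0 + h *: M1 + h ^+ 2 *: M2) i j = den.[h]^-1 * num.[h].
  move=> Ah; rewrite /gramian -bh -Sh /invmx.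
  have Su := lyap_mx_unit Ah; rewrite -Sh in Su; rewrite Su.
  have -> : \det (map_mx (horner_eval h) S) = den.[h] by rewrite det_map_mx.
  by rewrite -map_mx_adj -scalemxAr -map_mxM linearZ /= mxE -map_vec_mx mxE.
have den0 : den.[0] != 0.
  have : stable (A0 + 0 *: A1) by rewrite scale0r addr0.
  by move/lyap_mx_unit; rewrite -Sh unitmxE det_map_mx unitfE.
have lim : den.[h]^-1 * num.[h] @[h --> (0 : F)] --> den.[0]^-1 * num.[0].
  apply: cvgM; last exact: continuous_horner.
  by apply: cvgV => //; exact: continuous_horner.
have -> : gramian A0 M0 i j = den.[0]^-1 * num.[0].
  rewrite -E ?scale0r ?addr0 //; congr (gramian _ _ i j).
  by rewrite expr2 mul0r scale0r addr0.
apply: cvg_trans lim; apply: near_eq_cvg.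
by near=> h; apply/esym/E; near: h; exact: near_stable.
Unshelve. all: by end_near. Qed.

End Perturbation.

Section DerivativeJ.
Context {F : realType}.

(** The squared H2 norm of C (s - A)^-1 B, by [h2normE]. *)
Definition h2sq n m p (A : 'M[F]_n) (B : 'M[F]_(n, m)) (C : 'M[F]_(p, n)) : F :=
  \tr (C *m gramian A (B *m B^T) *m C^T).

Lemma tr_lyap_dual n (A X Y M N : 'M[F]_n) :
  A *m X + X *m A^T + M = 0 -> A^T *m Y + Y *m A + N = 0 ->
  \tr (N *m X) = \tr (Y *m M).
Proof.
move=> /eqP; rewrite addrC addr_eq0 => /eqP -> /eqP; rewrite addrC addr_eq0 => /eqP ->.
rewrite mulNmx mulmxN !raddfN /=; congr (- _).
rewrite mulmxDl mulmxDr !mxtraceD addrC; congr (_ + _); first by rewrite mulmxA.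
by rewrite -mulmxA mxtrace_mulC mulmxA.
Qed.

(** Exact variation of the squared norm, which mixes the controllability Gramian
    of the new system with the observability Gramian of the old one: duality
    turns tr (C^T C X') into tr (Y M'), where M' is the source term of the
    Lyapunov equation that X' satisfies for the old A. *)
Lemma h2sq_diff n m p (A A' : 'M[F]_n) (B B' : 'M[F]_(n, m)) (C C' : 'M[F]_(p, n)) :
  stable A -> stable A' ->
  let X' := gramian A' (B' *m B'^T) in
  let Y := gramian A^T (C^T *m C) in
  h2sq A' B' C' - h2sq A B C =
  \tr ((C'^T *m C' - C^T *m C) *m X') + \tr (Y *m (B' *m B'^T - B *m B^T))
  + 2 * \tr (Y *m (A' - A) *m X').
Proof.
move=> Ast Ast' X' Y.
have X's : X'^T = X' by rewrite gramian_sym // trmx_mul trmxK.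
have Ys : Y^T = Y.
  by apply: gramian_sym; [exact: stable_trmx | rewrite trmx_mul trmxK].
have eX := gramianP (B *m B^T) Ast.
have eX' := gramianP (B' *m B'^T) Ast'; rewrite -/X' in eX'.
have eY := gramianP (C^T *m C) (stable_trmx Ast); rewrite -/Y trmxK in eY.
have cyc (C0 : 'M[F]_(p, n)) X : \tr (C0 *m X *m C0^T) = \tr (C0^T *m C0 *m X).
  by rewrite mxtrace_mulC mulmxA.
have d1 := tr_lyap_dual eX eY.
have eX2 : A *m X' + X' *m A^T + (B' *m B'^T + (A' - A) *m X' + X' *m (A' - A)^T) = 0.
  rewrite -[RHS]eX' [(A' - A)^T]linearB /= mulmxBl mulmxBr.
  set a := A *m X'; set a' := A' *m X'; set b := X' *m A^T; set b' := X' *m A'^T.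
  by apply/matrixP => k l; rewrite !mxE; ring.
have d2 := tr_lyap_dual eX2 eY.
move: d2; clear eX2; move: (A' - A) => D d2.
have tD : \tr (Y *m (X' *m D^T)) = \tr (Y *m D *m X').
  by rewrite -mxtrace_tr !trmx_mul trmxK X's Ys mxtrace_mulC mulmxA.
rewrite /h2sq -/X' !cyc d1 mulmxBl raddfB /= d2 mulmxBr raddfB /=.
rewrite !mulmxDr !mxtraceD [Y *m (D *m _)]mulmxA tD.
ring.
Qed.

Lemma mxtrace_cvg n (M : 'M[F]_n) (X : F -> 'M[F]_n) (X0 : 'M[F]_n) (FF : set_system F) :
  Filter FF -> (forall i j, X h i j @[h --> FF] --> X0 i j) ->
  \tr (M *m X h) @[h --> FF] --> \tr (M *m X0).
Proof.
move=> fFF lim; apply: cvg_big => [|i _]; first exact: add_continuous.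
under eq_fun do rewrite mxE; rewrite mxE.
apply: cvg_big => [|j _]; first exact: add_continuous.
by apply: cvgM; [exact: cvg_cst | exact: lim].
Qed.

Section Line.
Variables (n m p : nat) (A0 A1 : 'M[F]_n) (B0 B1 : 'M[F]_(n, m)).
Variables (C0 C1 : 'M[F]_(p, n)).
Hypothesis Ast : stable A0.

Definition h2sq_slope : F :=
  let X := gramian A0 (B0 *m B0^T) in
  let Y := gramian A0^T (C0^T *m C0) in
  2 * (\tr (Y *m A1 *m X) + \tr (Y *m B1 *m B0^T) + \tr (X *m C0^T *m C1)).

Let phi h := h2sq (A0 + h *: A1) (B0 + h *: B1) (C0 + h *: C1).

(** After division by h, the right-hand side of [h2sq_diff] is continuous at 0
    because X' tends to X. *)
Lemma h2sq_line_cvg : h^-1 * (phi h - phi 0) @[h --> 0^'] --> h2sq_slope.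
Proof.
pose X h := gramian (A0 + h *: A1) ((B0 + h *: B1) *m (B0 + h *: B1)^T).
pose X0 := gramian A0 (B0 *m B0^T); pose Y := gramian A0^T (C0^T *m C0).
have gramD q r (M N : 'M[F]_(q, r)) h : (M + h *: N) *m (M + h *: N)^T =
    M *m M^T + h *: (M *m N^T + N *m M^T) + h ^+ 2 *: (N *m N^T).
  rewrite [(_ + _)^T]linearD /= [(h *: _)^T]linearZ /= mulmxDr !mulmxDl.
  rewrite -!scalemxAl -!scalemxAr scalerA -expr2 scalerDr.
  by rewrite -!addrA; congr (_ + _); rewrite addrCA.
have gramD' q r (M N : 'M[F]_(q, r)) h : (M + h *: N)^T *m (M + h *: N) =
    M^T *m M + h *: (M^T *m N + N^T *m M) + h ^+ 2 *: (N^T *m N).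
  by have := gramD _ _ M^T N^T h; rewrite !trmxK -[h *: N^T]linearZ -linearD /= trmxK.
have Xlim i j : X h i j @[h --> 0^'] --> X0 i j.
  apply: cvg_within_filter; rewrite /X.
  under eq_fun do rewrite gramD.
  exact: gramian_cvg.
have hlim : h @[h --> (0 : F)^'] --> (0 : F).
  by apply: cvg_within_filter; exact: cvg_id.
have tlim M := @mxtrace_cvg _ M X X0 _ _ Xlim.
have lim : \tr ((C0^T *m C1 + C1^T *m C0) *m X h) + h * \tr (C1^T *m C1 *m X h) +
    (\tr (Y *m (B0 *m B1^T + B1 *m B0^T)) + h * \tr (Y *m (B1 *m B1^T))) +
    2 * \tr (Y *m A1 *m X h) @[h --> 0^'] -->
    \tr ((C0^T *m C1 + C1^T *m C0) *m X0) + 0 * \tr (C1^T *m C1 *m X0) +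
    (\tr (Y *m (B0 *m B1^T + B1 *m B0^T)) + 0 * \tr (Y *m (B1 *m B1^T))) +
    2 * \tr (Y *m A1 *m X0).
  apply: cvgD; first apply: cvgD; first apply: cvgD; first exact: tlim.
  - by apply: cvgM; [exact: hlim | exact: tlim].
  - apply: cvgD; first exact: cvg_cst.
    by apply: cvgM; [exact: hlim | exact: cvg_cst].
  - by apply: cvgM; [exact: cvg_cst | exact: tlim].
move: lim; rewrite !mul0r !addr0.
have Xs : X0^T = X0 by rewrite gramian_sym // trmx_mul trmxK.
have Ys : Y^T = Y.
  by apply: gramian_sym; [exact: stable_trmx | rewrite trmx_mul trmxK].
have -> : \tr ((C0^T *m C1 + C1^T *m C0) *m X0) +
    \tr (Y *m (B0 *m B1^T + B1 *m B0^T)) + 2 * \tr (Y *m A1 *m X0) = h2sq_slope.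
  rewrite /h2sq_slope -/X0 -/Y mulmxDl mulmxDr !mxtraceD.
  have -> : \tr (C1^T *m C0 *m X0) = \tr (X0 *m C0^T *m C1).
    by rewrite -mxtrace_tr !trmx_mul trmxK Xs mulmxA.
  have -> : \tr (C0^T *m C1 *m X0) = \tr (X0 *m C0^T *m C1).
    by rewrite mxtrace_mulC mulmxA.
  have -> : \tr (Y *m (B0 *m B1^T)) = \tr (Y *m B1 *m B0^T).
    by rewrite -mxtrace_tr !trmx_mul trmxK Ys mxtrace_mulC mulmxA.
  rewrite [Y *m (B1 *m _)]mulmxA; ring.
move=> lim; apply: cvg_trans lim; apply: near_eq_cvg; near=> h.
have h0 : h != 0 by near: h; exact: nbhs_dnbhs_neq.
have Ah : stable (A0 + h *: A1).
  by near: h; apply: cvg_within; exact: near_stable.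
rewrite /phi !scale0r !addr0 h2sq_diff // -/Y -/(X h) gramD gramD'.
have sub (V : zmodType) (a b c : V) : a + b + c - a = b + c.
  by rewrite addrC -addrA addKr.
rewrite !sub; clear sub.
have -> : A0 + h *: A1 - A0 = h *: A1 by rewrite addrC addKr.
move: (X h) => Xh; rewrite !scalerDr !mulmxDl !mulmxDr -!scalemxAr -!scalemxAl.
rewrite !mxtraceD !mxtraceZ.
by field.
Unshelve. all: by end_near. Qed.

End Line.
End DerivativeJ.

(** * Square roots of positive definite matrices *)

Section SquareRoot.
Context {F : realType}.

Lemma interpolate (f : F -> F) (ds : seq F) :
  exists p : {poly F}, {in ds, forall d, p.[d] = f d}.
Proof.
elim: ds => [|d ds [p pP]]; first by exists 0.
have [dds|dds] := boolP (d \in ds).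
  by exists p => e; rewrite inE => /orP[/eqP ->|]; exact: pP.
pose q : {poly F} := \prod_(e <- ds) ('X - e%:P).
have q0 : q.[d] != 0 by rewrite -[_ == 0]/(root q d) root_prod_XsubC.
exists (p + ((f d - p.[d]) / q.[d])%:P * q) => e.
rewrite inE hornerD hornerM hornerC => /orP[/eqP ->|eds].
  by rewrite divfK // addrC subrK.
have /eqP -> : q.[e] == 0 by rewrite -[_ == 0]/(root q e) root_prod_XsubC.
by rewrite mulr0 addr0 pP.
Qed.

Lemma trmx_horner n (M : 'M[F]_n.+1) (p : {poly F}) : M^T = M ->
  (horner_mx M p)^T = horner_mx M p.
Proof.
move=> Ms; elim/poly_ind: p => [|p c IH]; first by rewrite rmorph0 trmx0.
rewrite rmorphD rmorphM /= horner_mx_X horner_mx_C linearD /= tr_scalar_mx.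
rewrite -[_ * M]/(_ *m M) trmx_mul Ms IH; congr (_ + _).
have := comm_mx_horner p (comm_mx_refl M) => /esym.
by [].
Qed.

(** The matrix - M is stable by [lyapunov_direct] with P = 1. *)
Lemma pd_eigenvalue n (M : 'M[F]_n) z : pd M ->
  eigenvalue (complex_mx M) z -> 0 < complex.Re z.
Proof.
move=> [Ms Mp] /eigenvalueP[v vM v0].
have P1 : pd (1%:M : 'M[F]_n).
  apply: psd_ker0_pd; last by move=> x; rewrite mul1mx.
  by have := psd_gram (1%:M : 'M[F]_n); rewrite mul1mx trmx1.
have st : stable (- M).
  apply: (lyapunov_direct P1) => x x0.
  rewrite mulmx1 mul1mx linearN /= Ms quadD quadN -mulr2n mulrn_wlt0 //.
  by rewrite oppr_lt0; exact: Mp.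
have := st (- z); case: z vM => a b vM; rewrite /= oppr_lt0; apply.
apply/eigenvalueP; exists v => //.
have -> : complex_mx (- M) = - complex_mx M by exact: map_mxN.
by rewrite mulmxN vM -scaleNr.
Qed.

(** Diagonalize M over F[i].  Its eigenvalues d are positive reals, and a real
    polynomial p interpolates their fourth roots; then T = p(M) is real
    symmetric with T^4 = M, and T^2 is the square root.  Using T^2 with
    T symmetric makes semidefiniteness automatic. *)
Lemma pd_sqrt n (M : 'M[F]_n) : pd M -> exists S, psd S /\ S *m S = M.
Proof.
case: n M => [|n] M Mp.
  exists 0; split; last by rewrite [RHS]flatmx0 mul0mx.
  split=> [|x]; first by rewrite trmx0.
  by rewrite mulmx0 mul0mx mxE.
have [Ms _] := Mp.
pose Mc := complex_mx M.
have herm : Mc \is hermsymmx.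
  apply: realsym_hermsym.
    by apply/is_hermitianmxP; rewrite expr0 scale1r map_mx_id // -complex_mxT Ms.
  by apply/mxOverP => i j; rewrite mxE; apply/complex_realP; exists (M i j).
have /orthomx_spectralP := hermitian_normalmx herm.
set P := spectralmx Mc; set sp := spectral_diag Mc => eM.
have Pu : P \in unitmx by exact: spectral_unit.
have spr i : sp 0 i = real_complex F (complex.Re (sp 0 i)).
  by apply/esym/RRe_real; apply/mxOverP; exact: hermitian_spectral_diag_real.
have spp i : 0 < complex.Re (sp 0 i).
  apply: (@pd_eigenvalue _ M) => //; apply/eigenvalueP; exists (row i P).
    rewrite -/Mc eM -row_mul !mulmxA mulmxV // mul1mx.
    by rewrite mul_diag_mx; apply/rowP => j; rewrite !mxE.
  apply: contraTneq Pu => rP0; rewrite -row_free_unit; apply/negP => /row_freeP[N PN].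
  have := congr1 (row i) PN; rewrite row_mul rP0 mul0mx.
  by move/rowP/(_ i); rewrite !mxE eqxx => /esym/eqP; rewrite oner_eq0.
have [p pP] := interpolate (fun d => Num.sqrt (Num.sqrt d))
  [seq complex.Re (sp 0 i) | i <- enum 'I_n.+1].
pose T := horner_mx M p; have Ts : T^T = T by exact: trmx_horner.
exists (T *m T); split; first by rewrite -{2}Ts; exact: psd_gram.
have -> : T *m T *m (T *m T) = horner_mx M (p ^+ 4).
  by rewrite rmorphXn /= -/T !exprS expr0 mulr1 -!mulmxA.
have : map_mx (real_complex F) (horner_mx M (p ^+ 4)) = Mc.
  rewrite [LHS]map_horner_mx -/(complex_mx M) -/Mc [in LHS]eM.
  rewrite [LHS](horner_mx_uconjC _ _ Pu) [RHS]eM.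
  congr (_ *m _ *m _); rewrite [LHS]horner_mx_diag; congr diag_mx.
  apply/rowP => i; rewrite mxE spr horner_map; congr (real_complex F _).
  rewrite horner_exp pP; last by apply/mapP; exists i; rewrite ?mem_enum.
  rewrite /= -[4%N]/(2 * 2)%N exprM !sqr_sqrtr ?sqrtr_ge0 //; exact: ltW.
by apply: map_mx_inj; exact: complexI.
Qed.

Lemma sqrtmxP n (M : 'M[F]_n) : pd M ->
  psd (sqrtmx M) /\ sqrtmx M *m sqrtmx M = M.
Proof.
by move=> /pd_sqrt [S SP]; rewrite /sqrtmx; case: xgetP => [S' _ //|/(_ S)].
Qed.

End SquareRoot.

(** * Controllability, blocks and traces *)

Section Structure.
Context {F : realType}.

(** The orbit of x under A^T stays in N, so x^T annihilates every A^k B, that is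
    the whole Kalman matrix.  Stating the invariant set as a predicate lets it be
    a projection of the kernel of a larger Gramian. *)
Lemma controllable_inv n l (A : 'M[F]_n) (B : 'M[F]_(n, l)) (N : 'cV[F]_n -> Prop) :
  controllable A B -> (forall x, N x -> B^T *m x = 0 /\ N (A^T *m x)) ->
  forall x, N x -> x = 0.
Proof.
move=> rk Ninv x Nx.
have Nk k : N ((A ^+ k)^T *m x).
  elim: k => [|k IH]; first by rewrite expr0 trmx1 mul1mx.
  by rewrite exprSr -[_ * A]/(_ *m A) trmx_mul -mulmxA; have [] := Ninv _ IH.
have : x^T *m \mxrow_(i < n) (A ^+ i *m B) = 0.
  rewrite mul_mxrow -[RHS](@mxrow0 _ n (fun=> l)); apply: eq_mxrow => i.
  apply: trmx_inj; rewrite !trmx_mul trmxK trmx0 -mulmxA.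
  by have [] := Ninv _ (Nk i).
have free : row_free (\mxrow_(i < n) (A ^+ i *m B)) by rewrite /row_free rk.
have [M MB] := row_freeP free.
move/(congr1 (mulmx^~ M)); rewrite /= -mulmxA MB mulmx1 mul0mx.
by move/(congr1 trmx); rewrite trmxK trmx0.
Qed.

Lemma controllable_dual n l (A : 'M[F]_n) (C : 'M[F]_(l, n)) :
  observable C A -> controllable A^T C^T.
Proof.
rewrite /observable /controllable -mxrank_tr tr_mxcol => rk; rewrite -[RHS]rk.
congr (\rank _); apply: eq_mxrow => i; rewrite trmx_mul; congr (_ *m _).
elim: (i : nat) => [|k IH]; first by rewrite !expr0 trmx1.
by rewrite exprS exprSr IH -[RHS]/((A ^+ k *m A)^T) trmx_mul.
Qed.

Section Blocks.
Variables (n1 n2 : nat).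
Implicit Type P : 'M[F]_(n1 + n2).

Lemma quad_block a b c d (x : 'cV[F]_n1) (y : 'cV[F]_n2) :
  quad (block_mx a b c d) (col_mx x y) =
  quad a x + (x^T *m b *m y) 0 0 + (y^T *m c *m x) 0 0 + quad d y.
Proof.
rewrite /quad tr_col_mx -mulmxA mul_block_col mul_row_col !mulmxDr !mulmxA.
by rewrite !mxE addrA.
Qed.

Lemma pd_drsubmx P : pd P -> pd (drsubmx P).
Proof.
move=> [Ps P0]; split; first by rewrite trmx_drsub Ps.
move=> x x0; have E : quad P (col_mx 0 x) = quad (drsubmx P) x.
  rewrite -[P in LHS]submxK quad_block trmx0 mulmx0 !mul0mx.
  by rewrite /quad mulmx0 !(mxE, add0r).
have := P0 (col_mx 0 x); rewrite -/(quad _ _) E; apply.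
apply: contraNneq x0 => /(congr1 dsubmx); rewrite col_mxKd => ->.
by apply/eqP/matrixP => i j; rewrite !mxE.
Qed.
End Blocks.

Lemma pd_inv n (P : 'M[F]_n) : pd P -> pd (invmx P).
Proof.
move=> Pp; have Pu := pd_unitmx Pp; have [Ps P0] := Pp.
split=> [|x x0]; first by rewrite trmx_inv Ps.
have -> : invmx P = invmx P *m P *m (invmx P)^T.
  by rewrite trmx_inv Ps mulVmx // mul1mx.
rewrite -/(quad _ x) quad_congr; apply: P0; apply: contraNneq x0 => /(congr1 (mulmx P^T)).
by rewrite trmx_inv mulKVmx ?unitmx_tr // mulmx0 => ->.
Qed.

Lemma pdZ n a (P : 'M[F]_n) : 0 < a -> pd P -> pd (a *: P).
Proof.
move=> a0 [Ps P0]; split=> [|x x0]; first by rewrite linearZ /= Ps.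
by rewrite -/(quad _ x) quadZ mulr_gt0 //; exact: P0.
Qed.

Lemma mxtrace_congr n p (M : 'M[F]_n) (N : 'M[F]_(p, n)) :
  \tr (N *m M *m N^T) = \sum_i quad M (row i N)^T.
Proof.
apply: eq_bigr => i _; rewrite /quad trmxK -[N in LHS]trmxK -[LHS]/((_ *m _) i i).
rewrite trmxK -row_mul !mxE; apply: eq_bigr => j _; congr (_ * _); by rewrite !mxE.
Qed.

Lemma psd_mxtrace_ge0 n p (M : 'M[F]_n) (N : 'M[F]_(p, n)) : psd M ->
  0 <= \tr (N *m M *m N^T).
Proof.
by move=> [_ M0]; rewrite mxtrace_congr sumr_ge0 // => i _; exact: M0.
Qed.

Lemma pd_mxtrace_gt0 n p (M : 'M[F]_n) (N : 'M[F]_(p, n)) : pd M -> N != 0 ->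
  0 < \tr (N *m M *m N^T).
Proof.
move=> Mp N0; rewrite lt_def psd_mxtrace_ge0 ?andbT; last exact: pd_psd.
apply: contra N0 => /eqP; rewrite mxtrace_congr => /psumr_eq0P q0.
apply/eqP/row_matrixP => i; rewrite row0; apply: trmx_inj; rewrite trmx0.
apply: (pd_ker0 Mp); apply: psd_quad_eq0; first exact: pd_psd.
by apply: q0 => // j _; have [_] := pd_psd Mp; apply.
Qed.

Lemma mxtrace_delta_eq0 n p (M : 'M[F]_(n, p)) :
  (forall i j, \tr (delta_mx i j *m M) = 0) -> M = 0.
Proof.
move=> M0; apply/matrixP => i j; rewrite [RHS]mxE -(M0 j i) mxtrace_mulC.
rewrite /mxtrace (bigD1 i) //= [X in _ + X]big1 => [|k ki]; last first.
  by rewrite mxE big1 // => l _; rewrite !mxE (negbTE ki) andbF mulr0.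
rewrite addr0 mxE (bigD1 j) //= big1 => [|l lj]; last first.
  by rewrite !mxE (negbTE lj) mulr0.
by rewrite !mxE !eqxx mulr1 addr0.
Qed.

End Structure.

(** * Algebra of the closed loop *)

Section ClosedLoopAlgebra.
Context {F : realType}.

(** An unreachable direction (x, y) satisfies Ws^T x = 0 and, as Vs is invertible,
    Bk^T y = 0.  The latter decouples x from y, so controllability of (A, Ws)
    gives x = 0, and then controllability of (Ak, Bk) gives y = 0.  The block E
    is arbitrary so that the dual system has the same shape. *)
Lemma closed_loop_gramian_pd n p (A E Ak : 'M[F]_n) (C : 'M[F]_(p, n))
    (Bk : 'M[F]_(n, p)) (Ws : 'M[F]_n) (Vs : 'M[F]_p) :
  let M := block_mx A E (Bk *m C) Ak in
  let N := block_mx Ws 0 0 (Bk *m Vs) in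
  stable M -> controllable A Ws -> controllable Ak Bk -> Vs \in unitmx ->
  pd (gramian M (N *m N^T)).
Proof.
move=> M N Mst cA cAk Vu; set X := gramian _ _.
have step (x y : 'cV[F]_n) : X *m col_mx x y = 0 ->
   [/\ Ws^T *m x = 0, Bk^T *m y = 0 &
     X *m col_mx (A^T *m x) (E^T *m x + Ak^T *m y) = 0].
  move=> /(gramian_ker Mst); rewrite -/X /N [M^T]tr_block_mx tr_block_mx !trmx0 !mul_block_col.
  rewrite !mul0mx addr0 add0r => -[/eqP]; rewrite col_mx_eq0 => /andP[/eqP Wx].
  rewrite trmx_mul -mulmxA => /eqP VBy.
  have By : Bk^T *m y = 0.
    have VTu : Vs^T \in unitmx by rewrite unitmx_tr.
    by rewrite -[LHS](mulKmx VTu) VBy mulmx0.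
  by rewrite trmx_mul -[C^T *m _ *m y]mulmxA By mulmx0 addr0.
apply: psd_ker0_pd; first exact: gramian_psd.
move=> z; rewrite -[z]vsubmxK; move: (usubmx z) (dsubmx z) => x y Xz.
have x0 : x = 0.
  apply: (controllable_inv (N := fun x => exists y, X *m col_mx x y = 0) cA).
    move=> u [v /step[Wu Bv Xu]]; split=> //; by eexists; exact: Xu.
  by exists y.
rewrite x0 in Xz *.
have -> : y = 0.
  apply: (controllable_inv (N := fun y => X *m col_mx 0 y = 0) cAk) => // v.
  by move=> /step[_ Bv]; rewrite !mulmx0 add0r.
by rewrite col_mx0.
Qed.

Section FilterRiccati.
Variables (n p : nat) (A E Ak : 'M[F]_n) (C : 'M[F]_(p, n)) (Bk : 'M[F]_(n, p)).
Variables (W : 'M[F]_n) (V : 'M[F]_p) (X : 'M[F]_(n + n)).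
Hypothesis Vu : V \in unitmx.
Let M := block_mx A E (Bk *m C) Ak.
Hypothesis Xs : X^T = X.
Hypothesis lyap : M *m X + X *m M^T + block_mx W 0 0 (Bk *m V *m Bk^T) = 0.
Hypothesis X22u : drsubmx X \in unitmx.

Definition schur (X : 'M[F]_(n + n)) : 'M[F]_n :=
  ulsubmx X - ursubmx X *m invmx (drsubmx X) *m dlsubmx X.

Let U := ursubmx X *m invmx (drsubmx X).
Hypothesis gain : U *m Bk *m V = schur X *m C^T.

Lemma schur_sym : (schur X)^T = schur X.
Proof.
rewrite /schur linearB /= !trmx_mul trmx_inv.
by rewrite trmx_ulsub trmx_dlsub trmx_drsub trmx_ursub Xs mulmxA.
Qed.

(** With U = X12 X22^-1, the row N = (1, - U) forms the estimation error, whose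
    covariance is the Schur complement: N X = (schur X, 0).  Multiplying the
    Lyapunov equation by N and N^T leaves A - U Bk C as error dynamics, and the
    gain condition eliminates U Bk. *)
Lemma filter_riccati : A *m schur X + schur X *m A^T + W
  - schur X *m C^T *m invmx V *m C *m schur X = 0.
Proof.
pose N := row_mx 1%:M (- U).
have NX : N *m X = row_mx (schur X) 0.
  rewrite -[X in N *m X]submxK mul_row_block !mul1mx !mulNmx.
  by rewrite {2}/U mulmxKV // subrr.
have XN : X *m N^T = col_mx (schur X) 0.
  by rewrite -[LHS]trmxK trmx_mul trmxK Xs NX tr_row_mx schur_sym trmx0.
have NM : N *m M *m col_mx (schur X) 0 = A *m schur X - U *m Bk *m C *m schur X.
  rewrite /N /M mul_row_block mul_row_col mulmx0 addr0 mul1mx mulNmx mulmxBl.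
  by rewrite mulmxA.
have UB : U *m Bk = schur X *m C^T *m invmx V.
  by rewrite -gain mulmxK.
have : N *m (M *m X) *m N^T + N *m (X *m M^T) *m N^T +
    N *m block_mx W 0 0 (Bk *m V *m Bk^T) *m N^T = 0.
  by rewrite -!mulmxDl -!mulmxDr lyap mulmx0 mul0mx.
have -> : N *m (M *m X) *m N^T = A *m schur X - U *m Bk *m C *m schur X.
  by rewrite -NM -XN !mulmxA.
have -> : N *m (X *m M^T) *m N^T = (A *m schur X - U *m Bk *m C *m schur X)^T.
  by rewrite -NM -XN !trmx_mul !trmxK Xs !mulmxA.
have -> : N *m block_mx W 0 0 (Bk *m V *m Bk^T) *m N^T =
    W + U *m Bk *m V *m Bk^T *m U^T.
  rewrite /N mul_row_block !mulmx0 mul1mx addr0 add0r tr_row_mx mul_row_col.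
  by rewrite trmx1 mulmx1 linearN /= mulmxN mulNmx mulNmx opprK !mulmxA.
have -> : U *m Bk *m V *m Bk^T *m U^T = schur X *m C^T *m (U *m Bk)^T.
  by rewrite gain [(U *m Bk)^T]trmx_mul !mulmxA.
have -> : (A *m schur X - U *m Bk *m C *m schur X)^T =
    schur X *m A^T - schur X *m C^T *m (U *m Bk)^T.
  by rewrite linearB /= !trmx_mul schur_sym !mulmxA.
rewrite -UB; move: (A *m _) (_ *m C *m schur X) (schur X *m A^T) => a b c.
move: (schur X *m C^T *m _) => d h; rewrite -[RHS]h.
by apply/matrixP => i j; rewrite !mxE; ring.
Qed.

End FilterRiccati.

(** Stationarity in A_K says that U^T Y12 = - Y22 for U = X12 X22^-1; inserting
    this in the stationarity equation of B_K leaves an invertible factor Y12.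
    Exchanging X and Y gives the statement for the feedback gain. *)
Lemma stationary_gain n p (C : 'M[F]_(p, n)) (Bk : 'M[F]_(n, p)) (V : 'M[F]_p)
    (X Y : 'M[F]_(n + n)) :
  X^T = X -> V^T = V ->
  drsubmx X \in unitmx -> drsubmx Y \in unitmx ->
  dlsubmx X *m ursubmx Y + drsubmx X *m drsubmx Y = 0 ->
  C *m (ulsubmx X *m ursubmx Y + ursubmx X *m drsubmx Y)
    + V *m Bk^T *m drsubmx Y = 0 ->
  ursubmx X *m invmx (drsubmx X) *m Bk *m V = schur X *m C^T.
Proof.
move=> Xs Vs Xu Yu stA stB.
set U := ursubmx X *m _.
have UT : U^T = invmx (drsubmx X) *m dlsubmx X.
  by rewrite trmx_mul trmx_inv trmx_drsub trmx_ursub Xs.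
have UY : U^T *m ursubmx Y = - drsubmx Y.
  rewrite UT -mulmxA; move/eqP: stA; rewrite addr_eq0 => /eqP ->.
  by rewrite mulmxN mulKmx.
have Y12u : ursubmx Y \in unitmx.
  have : U^T *m ursubmx Y \in unitmx by rewrite UY -scaleN1r unitmxZ ?unitrN1.
  by rewrite unitmx_mul => /andP[].
have SY : schur X *m ursubmx Y = ulsubmx X *m ursubmx Y + ursubmx X *m drsubmx Y.
  rewrite /schur -[_ *m invmx _ *m _]mulmxA -UT mulmxBl -mulmxA UY mulmxN opprK.
  by [].
apply: trmx_inj; rewrite [(U *m Bk *m V)^T]trmx_mul [(U *m Bk)^T]trmx_mul.
rewrite [(_ *m C^T)^T]trmx_mul trmxK schur_sym // Vs.
apply: (can_inj (mulmxK Y12u)); rewrite -[C *m _ *m _]mulmxA SY.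
move/eqP: stB; rewrite addr_eq0 => /eqP ->.
by rewrite -!mulmxA UY !mulmxN !mulmxA.
Qed.

End ClosedLoopAlgebra.

(** * Separation of control and estimation *)

Section Separation.
Context {F : realType}.
Variables (n m p : nat) (A : 'M[F]_n) (B : 'M[F]_(n, m)) (C : 'M[F]_(p, n)).
Variables (Ws Qs : 'M[F]_n) (Rs : 'M[F]_m) (Vs : 'M[F]_p).
Let W := Ws *m Ws^T.
Let V := Vs *m Vs^T.
Let Q := Qs^T *m Qs.
Let R := Rs^T *m Rs.
Hypotheses (Ru : R \in unitmx) (Vu : V \in unitmx).

Variables (Ak : 'M[F]_n) (Bk : 'M[F]_(n, p)) (Ck : 'M[F]_(m, n)).
Let M := block_mx A (B *m Ck) (Bk *m C) Ak.
Let Bc := block_mx Ws 0 0 (Bk *m Vs).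
Let Cc := block_mx Qs 0 0 (Rs *m Ck).

Lemma BcBcT : Bc *m Bc^T = block_mx W 0 0 (Bk *m V *m Bk^T).
Proof.
rewrite /Bc tr_block_mx !trmx0 mulmx_block !mulmx0 !mul0mx !addr0 !add0r.
by rewrite trmx_mul !mulmxA.
Qed.

Lemma CcTCc : Cc^T *m Cc = block_mx Q 0 0 (Ck^T *m R *m Ck).
Proof.
rewrite /Cc tr_block_mx !trmx0 mulmx_block !mulmx0 !mul0mx !addr0 !add0r.
by rewrite trmx_mul !mulmxA.
Qed.

Section Control.
Variable S : 'M[F]_n.
Hypothesis Ssym : S^T = S.
Hypothesis riccati : A^T *m S + S *m A + Q - S *m B *m invmx R *m B^T *m S = 0.

Let G := invmx R *m B^T *m S.

(** Completion of squares: substitute the Riccati equation for Q in tr (Q X11),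
    and the upper left block of the Lyapunov equation for the terms A X11. *)
Lemma cost_decomposition X : X^T = X -> M *m X + X *m M^T + Bc *m Bc^T = 0 ->
  \tr (Cc *m X *m Cc^T) =
  \tr (S *m W) + \tr (Rs *m row_mx G Ck *m X *m (Rs *m row_mx G Ck)^T).
Proof.
have Rsym : R^T = R by rewrite trmx_mul trmxK.
move=> Xs; rewrite BcBcT => lyap.
have cyc k (N : 'M[F]_(k, n + n)) : \tr (N *m X *m N^T) = \tr (N^T *m N *m X).
  by rewrite mxtrace_mulC mulmxA.
rewrite !cyc CcTCc trmx_mul mulmxA -[_ *m Rs^T *m Rs]mulmxA -/R.
have RG : R *m G = B^T *m S by rewrite /G !mulmxA mulmxV // mul1mx.
have GR : G^T *m R = S *m B by rewrite -{1}Rsym -trmx_mul RG trmx_mul Ssym trmxK.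
rewrite tr_row_mx [col_mx G^T _ *m R]mul_col_mx mul_col_row GR -[Ck^T *m R *m G]mulmxA RG.
have SBG : S *m B *m G = A^T *m S + S *m A + Q.
  by move/eqP: riccati; rewrite subr_eq0 => /eqP ->; rewrite /G !mulmxA.
rewrite SBG; clear SBG RG GR riccati.
move: Xs lyap; rewrite -[X]submxK; move: (ulsubmx X) (ursubmx X) (dlsubmx X) (drsubmx X).
move=> a b c d; rewrite tr_block_mx => /eq_block_mx[as_ cb bc ds].
rewrite /M tr_block_mx !mulmx_block !add_block_mx -block_mx0.
case/eq_block_mx => e11 _ _ _.
rewrite !mul0mx !mxtrace_block !add0r !addr0.
have tS := congr1 (fun Z => \tr (S *m Z)) e11.
rewrite /= mulmx0 mxtrace0 in tS.
rewrite -bc in tS e11 *.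
have t1 : \tr (S *m (a *m A^T)) = \tr (A^T *m S *m a).
  by rewrite mulmxA mxtrace_mulC mulmxA.
have t2 : \tr (S *m (b *m (B *m Ck)^T)) = \tr (S *m (B *m Ck *m b^T)).
  by rewrite -mxtrace_tr !trmx_mul !trmxK Ssym mxtrace_mulC !mulmxA.
have t3 : \tr (Ck^T *m (B^T *m S) *m b) = \tr (S *m (B *m Ck *m b^T)).
  by rewrite -mxtrace_tr !trmx_mul !trmxK Ssym mxtrace_mulC !mulmxA.
move: tS; rewrite !mulmxDr !mxtraceD !mulmxDl !mxtraceD t1 t2 t3.
rewrite -[S *m B *m Ck *m b^T]mulmxA [S *m B *m (Ck *m _)]mulmxA.
rewrite -[S *m A *m a]mulmxA -[S *m B *m Ck]mulmxA -[S *m (B *m Ck) *m _]mulmxA.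
move=> h.
lra.
Qed.

End Control.

Section Estimation.
Variable S : 'M[F]_n.
Hypothesis Ssym : S^T = S.
Hypothesis riccati : A *m S + S *m A^T + W - S *m C^T *m invmx V *m C *m S = 0.
Hypothesis Mst : stable M.

(** The Riccati equation makes the difference solve a Lyapunov equation of the
    closed loop with source L L^T, where L stacks S C^T V^-1 Vs and Bk Vs: both
    the optimal filter and the policy are driven by the same measurement
    noise. *)
Lemma error_covariance_bound X : M *m X + X *m M^T + Bc *m Bc^T = 0 ->
  psd (X - block_mx S 0 0 0).
Proof.
move=> lyap; have Vsym : V^T = V by rewrite trmx_mul trmxK.
pose L := col_mx (S *m C^T *m invmx V *m Vs) (Bk *m Vs).
have LL : L *m L^T = block_mx (S *m C^T *m invmx V *m C *m S) (S *m C^T *m Bk^T)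
    (Bk *m C *m S) (Bk *m V *m Bk^T).
  rewrite /L tr_col_mx mul_col_row; congr block_mx.
  - rewrite !trmx_mul trmx_inv Vsym trmxK Ssym !mulmxA -[_ *m Vs *m Vs^T]mulmxA -/V.
    by rewrite -[_ *m invmx V *m V]mulmxA mulVmx // mulmx1.
  - rewrite !trmx_mul !mulmxA -[_ *m Vs *m Vs^T]mulmxA -/V.
    by rewrite -[_ *m invmx V *m V]mulmxA mulVmx // mulmx1.
  - rewrite !trmx_mul trmx_inv Vsym trmxK Ssym !mulmxA -[_ *m Vs *m Vs^T]mulmxA -/V.
    by rewrite -[_ *m V *m invmx V]mulmxA mulmxV // mulmx1.
  - by rewrite trmx_mul !mulmxA -[_ *m Vs *m Vs^T]mulmxA.
suff -> : X - block_mx S 0 0 0 = gramian M (L *m L^T) by exact: gramian_psd.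
apply: gramian_uniq => //; rewrite LL mulmxBr mulmxBl addrACA -opprD.
move/eqP: lyap; rewrite addr_eq0 => /eqP ->; rewrite BcBcT.
rewrite /M tr_block_mx !mulmx_block !mulmx0 !mul0mx !addr0.
rewrite add_block_mx !opp_block_mx !add_block_mx -block_mx0 !addr0 !add0r !oppr0.
congr block_mx.
- move: riccati; move: (A *m S) (S *m A^T) (_ *m C *m S) => x y z h.
  by rewrite -[RHS]h; apply/matrixP => i j; move/matrixP/(_ i j): h; rewrite !mxE; lra.
- by rewrite add0r trmx_mul mulmxA addNr.
- by rewrite add0r addNr.
- by rewrite addr0 addNr.
Qed.

End Estimation.
End Separation.

(** * Derivatives of the LQG cost *)

Section LQGGradient.
Context {F : realType} {n m p : nat}.
Variables (A : 'M[F]_n) (B : 'M[F]_(n, m)) (C : 'M[F]_(p, n)).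
Variables (Q W : 'M[F]_n) (R : 'M[F]_m) (V : 'M[F]_p).
Implicit Types K v : 'M[F]_(m + n, p + n).

Let J := lqg_cost A B C Q W R V.
Let cost2 K := h2sq (Acl A B C K) (Bcl W V K) (Ccl Q R K).

Lemma lqg_costE K : stable (Acl A B C K) -> J K = Num.sqrt (cost2 K).
Proof. by move=> Kst; exact: h2normE Kst (gramianP _ Kst). Qed.

Definition dAcl v : 'M[F]_(n + n) := block_mx 0 (B *m polC v) (polB v *m C) (polA v).
Definition dBcl v : 'M[F]_(n + n, n + p) := block_mx 0 0 0 (polB v *m sqrtmx V).
Definition dCcl v : 'M[F]_(n + m, n + n) := block_mx 0 0 0 (sqrtmx R *m polC v).

Lemma polA_line h v K : polA (h *: v + K) = polA K + h *: polA v.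
Proof. by apply/matrixP => i j; rewrite !mxE addrC. Qed.
Lemma polB_line h v K : polB (h *: v + K) = polB K + h *: polB v.
Proof. by apply/matrixP => i j; rewrite !mxE addrC. Qed.
Lemma polC_line h v K : polC (h *: v + K) = polC K + h *: polC v.
Proof. by apply/matrixP => i j; rewrite !mxE addrC. Qed.

Lemma Acl_line h v K : Acl A B C (h *: v + K) = Acl A B C K + h *: dAcl v.
Proof.
rewrite /Acl polA_line polB_line polC_line /dAcl scale_block_mx add_block_mx.
by rewrite scaler0 addr0 mulmxDr mulmxDl -scalemxAr -scalemxAl.
Qed.
Lemma Bcl_line h v K : Bcl W V (h *: v + K) = Bcl W V K + h *: dBcl v.
Proof.
rewrite /Bcl polB_line /dBcl scale_block_mx add_block_mx.
by rewrite !scaler0 !addr0 mulmxDl -scalemxAl.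
Qed.
Lemma Ccl_line h v K : Ccl Q R (h *: v + K) = Ccl Q R K + h *: dCcl v.
Proof.
rewrite /Ccl polC_line /dCcl scale_block_mx add_block_mx.
by rewrite !scaler0 !addr0 mulmxDr -scalemxAr.
Qed.

(** The cost agrees with the square root of [h2sq] at stabilizing policies,
    which form a neighbourhood of K on the line by [near_stable]. *)
Lemma lqg_derive K v : stable (Acl A B C K) -> 0 < cost2 K ->
  'D_v J K = (2 * Num.sqrt (cost2 K))^-1 *
    h2sq_slope (Acl A B C K) (dAcl v) (Bcl W V K) (dBcl v) (Ccl Q R K) (dCcl v).
Proof.
move=> Kst c0; set slope := h2sq_slope _ _ _ _ _ _.
pose phi h := cost2 (h *: v + K).
have phi0 : phi 0 = cost2 K by rewrite /phi scale0r add0r.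
have lim : h^-1 * (phi h - phi 0) @[h --> 0^'] --> slope.
  have -> : phi = fun h => h2sq (Acl A B C K + h *: dAcl v)
      (Bcl W V K + h *: dBcl v) (Ccl Q R K + h *: dCcl v).
    by apply/funext => h; rewrite /phi /cost2 Acl_line Bcl_line Ccl_line.
  exact: h2sq_line_cvg.
have lim1 : h^-1 *: ((phi \o shift 0) (h *: 1) - phi 0) @[h --> 0^'] --> slope.
  under eq_fun do rewrite /= addr0 [_ *: 1]mulr1.
  exact: lim.
have dphi : is_derive (0 : F) (1 : F) phi slope.
  by split; [apply/cvg_ex; exists slope | apply/cvg_lim].
have dsq : is_derive (phi 0) (1 : F) Num.sqrt (2 * Num.sqrt (phi 0))^-1.
  by apply: is_derive1_sqrt; rewrite phi0.
have [dJ Jval] := is_derive1_comp dsq dphi.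
rewrite -phi0 -Jval; apply: cvg_lim => //; apply: cvg_trans dJ.
apply: near_eq_cvg; near=> h.
have Kh : stable (Acl A B C (h *: v + K)).
  by rewrite Acl_line; near: h; apply: cvg_within; exact: near_stable.
by rewrite /= addr0 [_ *: 1]mulr1 /phi scale0r add0r !lqg_costE.
Unshelve. all: by end_near. Qed.

End LQGGradient.

(** * Stationary policies *)

Section Stationarity.
Context {F : realType} {n m p : nat}.
Variables (A : 'M[F]_n) (B : 'M[F]_(n, m)) (C : 'M[F]_(p, n)).
Variables (Q W : 'M[F]_n) (R : 'M[F]_m) (V : 'M[F]_p).
Variable K : 'M[F]_(m + n, p + n).
Hypothesis Kst : stable (Acl A B C K).

Let X := gramian (Acl A B C K) (Bcl W V K *m (Bcl W V K)^T).
Let Y := gramian (Acl A B C K)^T ((Ccl Q R K)^T *m Ccl Q R K).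

(** The slope in direction v as a linear functional of the three blocks of v;
    the cofactors of these blocks are the partial gradients of the squared
    cost, up to transposition and the factor 2. *)
Lemma slopeE v :
  h2sq_slope (Acl A B C K) (dAcl B C v) (Bcl W V K) (dBcl V v) (Ccl Q R K) (dCcl R v) =
  2 * (\tr (polA v *m (dlsubmx X *m ursubmx Y + drsubmx X *m drsubmx Y)) +
   \tr (polB v *m (C *m (ulsubmx X *m ursubmx Y + ursubmx X *m drsubmx Y) +
      sqrtmx V *m (sqrtmx V)^T *m (polB K)^T *m drsubmx Y)) +
   \tr (polC v *m ((dlsubmx X *m ulsubmx Y + drsubmx X *m dlsubmx Y) *m B +
      drsubmx X *m (polC K)^T *m ((sqrtmx R)^T *m sqrtmx R)))).
Proof.
rewrite /h2sq_slope -/X -/Y; congr (2 * _).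
have -> : \tr (Y *m dAcl B C v *m X) = \tr (dAcl B C v *m (X *m Y)).
  by rewrite -mulmxA mxtrace_mulC -!mulmxA.
have -> : \tr (Y *m dBcl V v *m (Bcl W V K)^T) = \tr (dBcl V v *m (Bcl W V K)^T *m Y).
  by rewrite -mulmxA mxtrace_mulC.
have -> : \tr (X *m (Ccl Q R K)^T *m dCcl R v) = \tr (dCcl R v *m X *m (Ccl Q R K)^T).
  by rewrite [LHS]mxtrace_mulC mulmxA.
clearbody X Y; rewrite -[X]submxK -[Y]submxK.
rewrite !block_mxKul !block_mxKur !block_mxKdl !block_mxKdr.
move: (ulsubmx X) (ursubmx X) (dlsubmx X) (drsubmx X) => a b c d.
move: (ulsubmx Y) (ursubmx Y) (dlsubmx Y) (drsubmx Y) => e f g h.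
rewrite /dAcl /dBcl /dCcl /Bcl /Ccl !tr_block_mx !mulmx_block !trmx0.
rewrite !mul0mx !mulmx0 !addr0 !add0r !mul0mx !mxtrace_block ?mulmx0 ?mxtrace0 ?addr0 ?add0r.
have rotB N : \tr (B *m polC v *m N) = \tr (polC v *m (N *m B)).
  by rewrite -mulmxA mxtrace_mulC mulmxA.
have -> : \tr (sqrtmx R *m polC v *m d *m (sqrtmx R *m polC K)^T) =
    \tr (polC v *m (d *m (polC K)^T *m ((sqrtmx R)^T *m sqrtmx R))).
  by rewrite trmx_mul -!mulmxA mxtrace_mulC !mulmxA.
rewrite trmx_mul !mulmxDr !mulmxDl !mulmxDr !mxtraceD !rotB mxtrace0 !mulmxA.
ring.
Qed.

Hypothesis cost_gt0 : 0 < h2sq (Acl A B C K) (Bcl W V K) (Ccl Q R K).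
Hypothesis stationary : gradient (lqg_cost A B C Q W R V) K = 0.

(** The cost is positive, so its derivatives vanish exactly when those of its
    square do; testing [slopeE] on elementary matrices isolates the cofactors. *)
Lemma lqg_stationary :
  [/\ dlsubmx X *m ursubmx Y + drsubmx X *m drsubmx Y = 0,
    C *m (ulsubmx X *m ursubmx Y + ursubmx X *m drsubmx Y) +
      sqrtmx V *m (sqrtmx V)^T *m (polB K)^T *m drsubmx Y = 0 &
    (dlsubmx X *m ulsubmx Y + drsubmx X *m dlsubmx Y) *m B +
      drsubmx X *m (polC K)^T *m ((sqrtmx R)^T *m sqrtmx R) = 0].
Proof.
have slope0 v : 'D_v (lqg_cost A B C Q W R V) K = 0 ->
    h2sq_slope (Acl A B C K) (dAcl B C v) (Bcl W V K) (dBcl V v) (Ccl Q R K)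
      (dCcl R v) = 0.
  rewrite lqg_derive // => /eqP; rewrite mulf_eq0 invr_eq0 mulf_eq0 pnatr_eq0 /=.
  by rewrite sqrtr_eq0 leNgt cost_gt0 /= => /eqP.
have two0 : 2 != 0 :> F by rewrite pnatr_eq0.
move: stationary; rewrite /gradient -block_mx0 => /eq_block_mx[_ gC gB gA].
split; apply: mxtrace_delta_eq0 => i j; apply: (mulfI two0); rewrite mulr0.
- move/matrixP/(_ i j): gA; rewrite mxE mxE => /slope0.
  rewrite slopeE /polA /polB /polC block_mxKur block_mxKdl block_mxKdr.
  by rewrite !mul0mx !mxtrace0 !addr0.
- move/matrixP/(_ i j): gB; rewrite mxE mxE => /slope0.
  rewrite slopeE /polA [polB (block_mx _ _ _ _)]block_mxKdl /polC block_mxKur block_mxKdr.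
  by rewrite !mul0mx !mxtrace0 add0r addr0.
- move/matrixP/(_ i j): gC; rewrite mxE mxE => /slope0.
  rewrite slopeE /polA /polB [polC (block_mx _ _ _ _)]block_mxKur block_mxKdl block_mxKdr.
  by rewrite !mul0mx !mxtrace0 !add0r.
Qed.

End Stationarity.

Section Nondegenerate.
Context {F : realType} {n m p : nat}.
Variables (A : 'M[F]_n) (B : 'M[F]_(n, m)) (C : 'M[F]_(p, n)).
Variables (Q W : 'M[F]_n) (R : 'M[F]_m) (V : 'M[F]_p).

(** The certificate is P = g X^-1 and Gamma = g^-1 Ccl X Ccl^T, with g the cost:
    both block matrices are then congruences, of g times the identity and of
    g^-1 X respectively, and the trace of Gamma is g^2 / g. *)
Lemma nondegenerate_of_gramian K X :
  0 < lqg_cost A B C Q W R V K ->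
  lqg_cost A B C Q W R V K ^+ 2 = \tr (Ccl Q R K *m X *m (Ccl Q R K)^T) ->
  pd X ->
  Acl A B C K *m X + X *m (Acl A B C K)^T + Bcl W V K *m (Bcl W V K)^T = 0 ->
  ursubmx X \in unitmx -> lqg_nondegenerate A B C Q W R V K.
Proof.
rewrite /lqg_nondegenerate; set g := lqg_cost _ _ _ _ _ _ _ _.
set M := Acl _ _ _ _; set N := Bcl _ _ _; set L := Ccl _ _ _.
move=> g0 cost Xp lyap X12u; have [Xs _] := Xp; have Xu := pd_unitmx Xp.
have g1 : g != 0 by rewrite gt_eqF.
have Xip := pd_inv Xp; have [Xis _] := Xip.
exists (g *: invmx X), (g^-1 *: (L *m X *m L^T)); split.
- split; first exact: pdZ.
  have XXi : X *m invmx X = 1%:M by rewrite mulmxV.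
  have : ulsubmx X *m ursubmx (invmx X) = - (ursubmx X *m drsubmx (invmx X)).
    move: XXi; rewrite -{1}[X]submxK -{1}[invmx X]submxK mulmx_block.
    rewrite (scalar_mx_block n n 1) => /eq_block_mx[_ h _ _].
    by apply/eqP; rewrite -addr_eq0 h.
  have u : - (ursubmx X *m drsubmx (invmx X)) \in unitmx.
    rewrite -scaleN1r unitmxZ ?unitrN1 // unitmx_mul X12u.
    exact: pd_unitmx (pd_drsubmx Xip).
  move=> h; move: u; rewrite -h unitmx_mul => /andP[_ Pu].
  have -> : ursubmx (g *: invmx X) = g *: ursubmx (invmx X).
    by apply/matrixP => i j; rewrite !mxE.
  by rewrite unitmxZ // unitfE.
- by rewrite linearZ /= !trmx_mul trmxK Xs mulmxA.
- have N1T : (- 1%:M)^T = - 1%:M :> 'M[F]_(n + p) by rewrite raddfN /= trmx1.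
  have -> : - block_mx (M^T *m (g *: invmx X) + g *: invmx X *m M)
      (g *: invmx X *m N) (N^T *m (g *: invmx X)) (- g%:M) =
      g *: (col_mx (invmx X *m N) (- 1%:M) *m (col_mx (invmx X *m N) (- 1%:M))^T).
    rewrite tr_col_mx mul_col_row scale_block_mx opp_block_mx; congr block_mx.
    + rewrite trmx_mul Xis -!scalemxAl -!scalemxAr -scalerDr -scalerN; congr (_ *: _).
      have -> : invmx X *m N *m (N^T *m invmx X) = invmx X *m (N *m N^T) *m invmx X.
        by rewrite !mulmxA.
      have -> : N *m N^T = - (M *m X + X *m M^T).
        by apply/eqP; rewrite -addr_eq0 addrC lyap.
      rewrite mulmxN mulNmx mulmxDr mulmxDl; congr (- _).
      rewrite !mulmxA mulVmx // mul1mx addrC -!mulmxA; congr (_ + _).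
      by rewrite mulmxV // mulmx1.
    + by rewrite N1T mulmxN mulmx1 -scalemxAl scalerN.
    + by rewrite trmx_mul Xis mulNmx mul1mx -scalemxAr scalerN.
    + by rewrite N1T mulNmx mulmxN mulmx1 !opprK scalemx1.
  by apply: psdZ; [exact: ltW | exact: psd_gram].
- have ZT : (g *: invmx X)^T = g *: invmx X by rewrite linearZ /= Xis.
  have gX1 : (g *: invmx X) *m (g^-1 *: X) = 1%:M.
    by rewrite -scalemxAl -scalemxAr scalerA divff // scale1r mulVmx.
  have gX2 : (g^-1 *: X) *m (g *: invmx X) = 1%:M.
    by rewrite -scalemxAl -scalemxAr scalerA mulVf // scale1r mulmxV.
  have -> : block_mx (g *: invmx X) L^T L (g^-1 *: (L *m X *m L^T)) =
      col_mx (g *: invmx X) L *m (g^-1 *: X) *m (col_mx (g *: invmx X) L)^T.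
    rewrite mul_col_mx tr_col_mx mul_col_row ZT; congr block_mx.
    + by rewrite gX1 mul1mx.
    + by rewrite gX1 mul1mx.
    + by rewrite -mulmxA gX2 mulmx1.
    + by rewrite -scalemxAr -scalemxAl.
  apply: psd_congr; apply: psdZ; first by rewrite invr_ge0 ltW.
  exact: pd_psd.
- by rewrite mxtraceZ -cost expr2 mulrA mulVf // mul1r.
Qed.

End Nondegenerate.

(** * Optimality *)

Section Optimality.
Context {F : realType} {n m p : nat}.
Variables (A : 'M[F]_n) (B : 'M[F]_(n, m)) (C : 'M[F]_(p, n)).
Variables (Q W : 'M[F]_n) (R : 'M[F]_m) (V : 'M[F]_p).
Let V' := sqrtmx V *m (sqrtmx V)^T.
Let R' := (sqrtmx R)^T *m sqrtmx R.
Let W' := sqrtmx W *m (sqrtmx W)^T.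
Let Q' := (sqrtmx Q)^T *m sqrtmx Q.
Hypotheses (Vu : V' \in unitmx) (Ru : R' \in unitmx).
Variables (Sf Sc : 'M[F]_n).
Hypotheses (Sf_sym : Sf^T = Sf) (Sc_sym : Sc^T = Sc).
Hypothesis filter : A *m Sf + Sf *m A^T + W' - Sf *m C^T *m invmx V' *m C *m Sf = 0.
Hypothesis control : A^T *m Sc + Sc *m A + Q' - Sc *m B *m invmx R' *m B^T *m Sc = 0.

Let G := invmx R' *m B^T *m Sc.
Let gram K := gramian (Acl A B C K) (Bcl W V K *m (Bcl W V K)^T).

Definition optimal_cost2 := \tr (Sc *m W') +
  \tr (sqrtmx R *m G *m Sf *m (sqrtmx R *m G)^T).

(** Only the last term depends on K, through the difference of
    [error_covariance_bound]. *)
Lemma cost_split K : stable (Acl A B C K) ->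
  h2sq (Acl A B C K) (Bcl W V K) (Ccl Q R K) = optimal_cost2 +
  \tr (sqrtmx R *m row_mx G (polC K) *m (gram K - block_mx Sf 0 0 0)
    *m (sqrtmx R *m row_mx G (polC K))^T).
Proof.
move=> Kst.
have Xs : (gram K)^T = gram K by apply: gramian_sym => //; rewrite trmx_mul trmxK.
rewrite [LHS](cost_decomposition Ru Sc_sym control Xs (gramianP _ Kst)).
rewrite /optimal_cost2 -addrA; congr (_ + _).
rewrite mulmxBr mulmxBl raddfB /= addrC.
have -> : sqrtmx R *m row_mx G (polC K) *m block_mx Sf 0 0 0
    *m (sqrtmx R *m row_mx G (polC K))^T = sqrtmx R *m G *m Sf *m (sqrtmx R *m G)^T.
  rewrite mul_mx_row mul_row_block !mulmx0 !addr0 tr_row_mx mul_row_col.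
  by rewrite mul0mx addr0.
by rewrite subrK.
Qed.

Lemma cost_lower_bound K : stable (Acl A B C K) ->
  optimal_cost2 <= h2sq (Acl A B C K) (Bcl W V K) (Ccl Q R K).
Proof.
move=> Kst; rewrite cost_split // lerDl; apply: psd_mxtrace_ge0.
exact: (error_covariance_bound Vu Sf_sym filter Kst (gramianP _ Kst)).
Qed.

End Optimality.

Lemma sqrtmx_unit (F : realType) n (M : 'M[F]_n) : pd M -> sqrtmx M \in unitmx.
Proof.
move=> Mp; have [_ SS] := sqrtmxP Mp; have := pd_unitmx Mp.
by rewrite -{1}SS unitmx_mul => /andP[].
Qed.

Theorem theorem4p3 (F : realType) (n m p : nat)
  (n_ge1 : (1 <= n)%N) (m_ge1 : (1 <= m)%N) (p_ge1 : (1 <= p)%N)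
  (A : 'M[F]_n) (B : 'M[F]_(n, m)) (C : 'M[F]_(p, n))
  (Q W : 'M[F]_n) (R : 'M[F]_m) (V : 'M[F]_p)
  (Q_psd : psd Q) (W_psd : psd W) (R_pd : pd R) (V_pd : pd V)
  (AB_ctrb : controllable A B) (AW_ctrb : controllable A (sqrtmx W))
  (CA_obsv : observable C A) (QA_obsv : observable (sqrtmx Q) A)
  (Kstar : 'M[F]_(m + n, p + n))
  (Kstar_stab : stabilizing A B C Kstar)
  (Kstar_stationary : gradient (lqg_cost A B C Q W R V) Kstar = 0)
  (Kstar_ctrb : controllable (polA Kstar) (polB Kstar))
  (Kstar_obsv : observable (polC Kstar) (polA Kstar)) :
  lqg_nondegenerate A B C Q W R V Kstar /\
  (forall K : 'M[F]_(m + n, p + n), stabilizing A B C K ->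
     lqg_cost A B C Q W R V Kstar <= lqg_cost A B C Q W R V K).
Proof.
have [_ Kst] := Kstar_stab.
set M := Acl A B C Kstar in Kst; set N := Bcl W V Kstar; set L := Ccl Q R Kstar.
pose X := gramian M (N *m N^T); pose Y := gramian M^T (L^T *m L).
have Vu := sqrtmx_unit V_pd; have Ru := sqrtmx_unit R_pd.
have Mst := stable_trmx Kst.
have Xp : pd X.
  exact: (@closed_loop_gramian_pd F n p A (B *m polC Kstar) (polA Kstar) C
    (polB Kstar) (sqrtmx W) (sqrtmx V) Kst AW_ctrb Kstar_ctrb Vu).
have MT : M^T = block_mx A^T (polB Kstar *m C)^T ((polC Kstar)^T *m B^T) (polA Kstar)^T.
  by rewrite /M /Acl tr_block_mx -trmx_mul.
have LT : L^T = block_mx (sqrtmx Q)^T 0 0 ((polC Kstar)^T *m (sqrtmx R)^T).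
  by rewrite /L /Ccl tr_block_mx !trmx0 -trmx_mul.
have Yp : pd Y.
  rewrite /Y -[L in _ *m L]trmxK.
  rewrite MT LT; apply: (@closed_loop_gramian_pd F n m A^T
    (polB Kstar *m C)^T (polA Kstar)^T B^T (polC Kstar)^T (sqrtmx Q)^T
    (sqrtmx R)^T); rewrite -?MT ?unitmx_tr //; exact: controllable_dual.
have [Xs _] := Xp; have [Ys _] := Yp.
have X22u := pd_unitmx (pd_drsubmx Xp); have Y22u := pd_unitmx (pd_drsubmx Yp).
have lX : M *m X + X *m M^T + N *m N^T = 0 by exact: gramianP.
have lY : M^T *m Y + Y *m M^T^T + L^T *m L = 0 by exact: gramianP.
(* A zero Ccl would contain a zero square root of Q, which cannot observe
   anything since n >= 1; hence the cost is positive, and the square root is differentiable there. *)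
have L0 : L != 0.
  apply/negP => /eqP L0; have Q0 : sqrtmx Q = 0.
    by have := congr1 ulsubmx L0; rewrite /L /Ccl block_mxKul => ->; apply/matrixP => i j; rewrite !mxE.
  have := @controllable_inv F n n A^T (sqrtmx Q)^T (fun=> True) (controllable_dual QA_obsv).
  rewrite Q0 !trmx0 => /(_ _ (const_mx 1) I) E.
  have /matrixP/(_ (Ordinal n_ge1) 0) : const_mx 1 = 0 :> 'cV[F]_n.
    by apply: E => x _; rewrite mul0mx.
  by rewrite !mxE => /eqP; rewrite oner_eq0.
have cost0 : 0 < h2sq M N L by exact: pd_mxtrace_gt0.
have [stA stB stC] := lqg_stationary Kst cost0 Kstar_stationary.
rewrite -/M -/N -/L -/X -/Y in stA stB stC.
(* Stationarity in A_K: X21 Y12 = - X22 Y22. *)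
have X12u : ursubmx X \in unitmx.
  have u : - (drsubmx X *m drsubmx Y) \in unitmx.
    by rewrite -scaleN1r unitmxZ ?unitrN1 // unitmx_mul X22u.
  move/eqP: stA; rewrite addr_eq0 => /eqP E; move: u.
  by rewrite -E unitmx_mul -unitmx_tr trmx_dlsub Xs => /andP[].
have costE : lqg_cost A B C Q W R V Kstar = Num.sqrt (h2sq M N L).
  exact: (lqg_costE Q W R V Kst).
split.
  have J0 : 0 < lqg_cost A B C Q W R V Kstar by rewrite costE sqrtr_gt0.
  have J2 : lqg_cost A B C Q W R V Kstar ^+ 2 = \tr (L *m X *m L^T).
    by rewrite costE; exact: sqr_sqrtr (ltW cost0).
  exact: (nondegenerate_of_gramian J0 J2 Xp lX X12u).
pose V' := sqrtmx V *m (sqrtmx V)^T; pose R' := (sqrtmx R)^T *m sqrtmx R.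
have Vs' : V'^T = V' by rewrite trmx_mul trmxK.
have Rs' : R'^T = R' by rewrite trmx_mul trmxK.
have Vu' : V' \in unitmx by rewrite unitmx_mul unitmx_tr Vu.
have Ru' : R' \in unitmx by rewrite unitmx_mul unitmx_tr Ru.
have gainF := stationary_gain Xs Vs' X22u Y22u stA stB.
(* The transposed equations are those of the dual system. *)
have stAT : dlsubmx Y *m ursubmx X + drsubmx Y *m drsubmx X = 0.
  move/(congr1 trmx): stA; rewrite linearD /= !trmx_mul trmx0.
  by rewrite trmx_ursub trmx_dlsub !trmx_drsub Xs Ys.
have stCT : B^T *m (ulsubmx Y *m ursubmx X + ursubmx Y *m drsubmx X)
    + R' *m ((polC Kstar)^T)^T *m drsubmx X = 0.
  have -> : ulsubmx Y *m ursubmx X + ursubmx Y *m drsubmx X =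
      (dlsubmx X *m ulsubmx Y + drsubmx X *m dlsubmx Y)^T.
    rewrite linearD /= !trmx_mul trmx_ulsub !trmx_dlsub !trmx_drsub.
    by rewrite Xs Ys.
  have -> : R' *m ((polC Kstar)^T)^T *m drsubmx X =
      (drsubmx X *m (polC Kstar)^T *m R')^T.
    by rewrite trmx_mul Rs' trmx_mul trmx_drsub Xs mulmxA.
  by rewrite -trmx_mul -linearD /= stC trmx0.
have gainC := stationary_gain Ys Rs' Y22u X22u stAT stCT.
have lXb := lX; rewrite BcBcT in lXb.
have filter := filter_riccati Vu' Xs lXb X22u gainF.
have lYb : M^T *m Y + Y *m M^T^T + block_mx ((sqrtmx Q)^T *m sqrtmx Q) 0 0
    ((polC Kstar)^T *m R' *m (polC Kstar)^T^T) = 0.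
  rewrite -[RHS]lY; congr (_ + _); rewrite [(polC Kstar)^T^T]trmxK.
  exact/esym/CcTCc.
rewrite MT in lYb.
have control := filter_riccati Ru' Ys lYb Y22u gainC.
rewrite !trmxK in control.
have Sfs := schur_sym Xs; have Scs := schur_sym Ys.
(* The range of X - diag(Sf, 0) is spanned by (U, 1) with U = X12 X22^-1, and
   the row (G, C_K) annihilates it because G U = - C_K. *)
have opt : h2sq M N L = optimal_cost2 B W R (schur X) (schur Y).
  rewrite [LHS](cost_split W V Ru' (schur X) Scs control Kst) -/X.
  pose G := invmx R' *m B^T *m schur Y.
  have Gur : G *m ursubmx X = - (polC Kstar *m drsubmx X).
    apply: (can_inj (@mulKmx _ _ _ _ Ru')); rewrite mulmxN /G !mulmxA mulmxV // mul1mx.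
    have -> : B^T *m schur Y = R' *m polC Kstar *m (invmx (drsubmx Y) *m dlsubmx Y).
      have := congr1 trmx gainC.
      rewrite [B^T^T]trmxK [(schur Y *m B)^T]trmx_mul Scs => <-.
      rewrite trmx_mul Rs' trmx_mul trmxK trmx_mul trmx_inv trmx_drsub trmx_ursub.
      by rewrite Ys mulmxA.
    rewrite -[_ *m ursubmx X]mulmxA -[invmx _ *m _ *m _]mulmxA.
    move/eqP: stAT; rewrite addr_eq0 => /eqP ->.
    by rewrite mulmxN mulKmx // mulmxN.
  have TZ : row_mx G (polC Kstar) *m (X - block_mx (schur X) 0 0 0) = 0.
    rewrite -[X in X - _]submxK opp_block_mx add_block_mx !oppr0 !addr0.
    rewrite {1}/schur opprB addrC subrK mul_row_block -row_mx0.
    congr row_mx; last by rewrite Gur addNr.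
    by rewrite !mulmxA Gur mulNmx mulmxK // mulNmx addNr.
  by rewrite -[sqrtmx R *m row_mx _ _ *m _]mulmxA TZ mulmx0 mul0mx mxtrace0 addr0.
move=> K [_ K_st]; rewrite costE (lqg_costE Q W R V K_st); apply: ler_wsqrtr.
by rewrite opt; exact: (cost_lower_bound Vu' Ru' Sfs Scs filter control K_st).
Qed.
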